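(* Let $n\ge1$ and $w\in B_n$, and let $\lambda(w)$ be the shape (a partition of $2n$) of the RSK insertion tableau of the sequence $w^0=(-w_n,\ldots,-w_1,w_1,\ldots,w_n)$ with respect to the order $-n<\cdots<-1<1<\cdots<n$. Then $w\in\mathrm{FC}(B_n)$ if and only if $\lambda(w)$ is admissible, i.e. \[ \lambda(w)\in\{(2n-k,k)\mid 0\le k\le n\}\cup\{(2n-2k,2k-1,1)\mid 1\le k\le\lfloor n/2\rfloor\}. \] Equivalently, $\mathrm{FC}(B_n)$ is the disjoint union of the two-sided combinatorial cells $\mathcal{C}_\lambda=\{w\in B_n\mid\lambda(w)=\lambda\}$ over the admissible shapes $\lambda$.
   Context: $B_n$ is the group of signed permutations $w=[w_1,\ldots,w_n]$ of $\{\pm1,\ldots,\pm n\}$ with Coxeter generators $s_0=[-1,2,\ldots,n]$ and $s_i=[1,\ldots,i-1,i+1,i,i+2,\ldots,n]$ ($1\le i\le n-1$). An element is fully commutative (FC) if any reduced expression can be obtained from any other using only commutation relations between commuting generators; $\mathrm{FC}(B_n)$ is the set of FC elements. RSK denotes the Robinson–Schensted row-insertion correspondence applied to a sequence of distinct totally ordered values. (The shape $\lambda(w)$ coincides with the common shape of the pair of domino tableaux assigned to $w$ by the Barbash–Vogan/Garfinkle domino insertion.) *)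

(* Defs.v *)
From Stdlib Require Import Relations.
From mathcomp Require Import all_boot all_order all_algebra.
Set Implicit Arguments. Unset Strict Implicit. Unset Printing Implicit Defensive.
Import Order.TTheory GRing.Theory Num.Theory.

(* A signed permutation w = [w_1,...,w_n] of {+-1,...,+-n} in window notation *)
Definition signed_perm (n : nat) (w : seq int) : Prop :=
  size w = n /\ perm_eq [seq absz x | x <- w] (iota 1 n).

Definition id_signed (n : nat) : seq int := [seq Posz i | i <- iota 1 n].

(* right multiplication by the Coxeter generator s_i:
   s_0 negates w_1; s_i (i >= 1) swaps w_i and w_{i+1} *)
Definition act_gen (w : seq int) (i : nat) : seq int :=
  if i == 0%N then set_nth 0%R w 0 (- nth 0%R w 0)%R
  else set_nth 0%R (set_nth 0%R w i.-1 (nth 0%R w i)) i (nth 0%R w i.-1).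

Definition eval_word (n : nat) (a : seq nat) : seq int := foldl act_gen (id_signed n) a.

Definition word_of (n : nat) (a : seq nat) : bool := all (fun i => i < n) a.

Definition reduced (n : nat) (w : seq int) (a : seq nat) : Prop :=
  word_of n a /\ eval_word n a = w /\
  forall b, word_of n b -> eval_word n b = w -> size a <= size b.

(* in B_n, s_i s_j = s_j s_i (i <> j) exactly when |i - j| >= 2 *)
Definition commuting (i j : nat) : bool := (i.+1 < j) || (j.+1 < i).

Inductive comm_step : seq nat -> seq nat -> Prop :=
| CommStep u v i j : commuting i j -> comm_step (u ++ i :: j :: v) (u ++ j :: i :: v).

Definition comm_equiv : seq nat -> seq nat -> Prop := clos_refl_trans _ comm_step.

Definition fully_commutative (n : nat) (w : seq int) : Prop :=
  forall a b, reduced n w a -> reduced n w b -> comm_equiv a b.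

Fixpoint bump_row (r : seq int) (x : int) : seq int * option int :=
  match r with
  | [::] => ([:: x], None)
  | y :: r' => if (x < y)%R then (x :: r', Some y)
               else let: (r2, o) := bump_row r' x in (y :: r2, o)
  end.

Fixpoint row_insert (t : seq (seq int)) (x : int) : seq (seq int) :=
  match t with
  | [::] => [:: [:: x]]
  | r :: t' => let: (r', o) := bump_row r x in
               match o with
               | None => r' :: t'
               | Some y => r' :: row_insert t' y
               end
  end.

Definition RSK_P (s : seq int) : seq (seq int) := foldl row_insert [::] s.

Definition w0 (w : seq int) : seq int := [seq (- x)%R | x <- rev w] ++ w.

Definition lambda (w : seq int) : seq nat := [seq size r | r <- RSK_P (w0 w)].

Definition admissible (n : nat) (lam : seq nat) : Prop :=
  (exists k, k <= n /\ lam = [seq m <- [:: (2 * n - k)%N; k] | m != 0%N])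
  \/ (exists k, 1 <= k <= n./2 /\ lam = [:: (2 * n - 2 * k)%N; (2 * k - 1)%N; 1%N]).

(* Main.v *)
Require Import Defs.
From Stdlib Require Import Relations.
From mathcomp Require Import all_boot all_order all_algebra.
From mathcomp Require Import zify.
Set Implicit Arguments. Unset Strict Implicit. Unset Printing Implicit Defensive.
Import Order.TTheory GRing.Theory Num.Theory.

(* Write w^0 as a function f on the positions 0, ..., 2n-1. Both sides of the equivalence
   say that w avoids two patterns: an entry 0 > w_i > w_j with i < j, and a decreasing
   triple in w^0 with three distinct absolute values.

   Fully commutative side. Removing a descent of w never creates a pattern, and in a
   pattern-avoiding w two distinct descents commute; induction on the length then connects
   any two reduced words. Conversely, as long as a pattern is present one can remove a
   descent and keep a pattern, until a braid relation applies; the subword of letters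
   i, i+1 is invariant under commutations but not under that braid.

   Tableau side. By Greene's theorem for columns, the patterns are excluded exactly when
   the shape has at most three rows and a third row of length at most 1. It remains to see
   that the first row has even length if there is a third row: then w has a unique negative
   entry, and a longest increasing subsequence of w^0 of odd length could be made longer
   by symmetrizing it under negation. *)

(** Both patterns are chosen to interact with the symmetry [f (2n-1-p) = - f p]. A pair
    [0 > w_i > w_j] and its opposite give a decreasing subsequence of length 4. A triple with
    distinct absolute values is disjoint from its mirror image, so together they give six letters
    covered by two decreasing subsequences. Without patterns neither occurs, since all decreasing
    triples then start at one and the same position. So the tableau side needs only the bounds 3 and
    5 on the first column and on the first two. The obstacle on the group side is to shrink a triple
    to consecutive positions: an entry may not be replaced by a neighbour that is opposite to
    another entry of the triple. In these cases a negative pair appears, or the removal of a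
    suitable descent keeps a free triple. Those two bounds cannot decide the parity of the first
    row: (2n-2k,2k-1,1) and (2n-2k-1,2k,1) agree in them for k > 1. This is why Schensted's theorem
    for the first row is needed as well. *)

(** * Patterns and descents *)

(* Right multiplication by s_i permutes the positions of w^0 by [tau n i]. For [i = 0] the
   last two branches are not reached. *)
Definition tau (n i p : nat) : nat :=
  if p == n + i then n + i - 1
  else if p == n + i - 1 then n + i
  else if p == n - i then n - i - 1
  else if p == n - i - 1 then n - i else p.

Ltac eqn_cases := repeat (match goal with
  |- context [?a == ?b :> nat] =>
     lazymatch constr:((a, b)) with context [if _ then _ else _] => fail | _ => case: (a =P b) => ? end
  end; cbv iota).

Definition neg_pair (n : nat) (f : nat -> int) : Prop :=
  exists i j, [/\ n <= i, i < j, j < n.*2, (f i < 0)%R & (f j < f i)%R].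

(* Position [p] of w^0 is opposite to position [q] when [p + q + 1 = 2n]. *)
Definition free_triple (n : nat) (f : nat -> int) : Prop :=
  exists p q r, [/\ [/\ p < q, q < r & r < n.*2],
    (f q < f p)%R /\ (f r < f q)%R &
    [/\ (p + q).+1 <> n.*2, (p + r).+1 <> n.*2 & (q + r).+1 <> n.*2]].

Definition bad (n : nat) (f : nat -> int) : Prop := neg_pair n f \/ free_triple n f.

(** The local forms on which a braid relation acts: of length 4 for [s_0, s_1] on the first two
    window entries, of length 3 for [s_k, s_{k+1}] on three consecutive ones. *)
Definition adj_bad (n : nat) (f : nat -> int) : Prop :=
  [/\ 1 < n, (f n < 0)%R & (f n.+1 < f n)%R] \/
  exists i, [/\ n <= i, i.+2 < n.*2, (f i.+1 < f i)%R & (f i.+2 < f i.+1)%R].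

Definition odd_fun (n : nat) (f : nat -> int) : Prop :=
  forall p q, (p + q).+1 = n.*2 -> f q = (- f p)%R.

Definition inj_fun (n : nat) (f : nat -> int) : Prop :=
  forall p q, p < n.*2 -> q < n.*2 -> f p = f q -> p = q.

Definition bad_below (n : nat) (f : nat -> int) : Prop :=
  exists i, [/\ i < n, (f (n + i)%N < f (n + i - 1)%N)%R & bad n (f \o tau n i)].

Lemma tauK n i : i < n -> involutive (tau n i).
Proof. by move=> h p; rewrite /tau; eqn_cases; lia. Qed.

Lemma tau_lt n i a b : i < n -> a < b ->
  ~ (a = n + i - 1 /\ b = n + i) -> ~ (a = n - i - 1 /\ b = n - i) -> tau n i a < tau n i b.
Proof. by move=> hi ab c1 c2; rewrite /tau; eqn_cases; lia. Qed.

Lemma ltn_tau n i a : i < n -> a < n.*2 -> tau n i a < n.*2.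
Proof. by move=> hi ha; rewrite /tau; eqn_cases; lia. Qed.

Lemma tau_ge n i a : i < n -> n <= a -> ~ (a = n /\ i = 0) -> n <= tau n i a.
Proof. by move=> hi ha c; rewrite /tau; eqn_cases; lia. Qed.

Lemma tau_mirror n i a b : i < n -> (a + b).+1 = n.*2 -> (tau n i a + tau n i b).+1 = n.*2.
Proof. move=> hi e; have -> : b = n.*2 - a.+1 by [lia]; rewrite /tau; eqn_cases; lia. Qed.

Lemma tau_nmirror n i a b : i < n -> (a + b).+1 <> n.*2 -> (tau n i a + tau n i b).+1 <> n.*2.
Proof. by move=> hi ne /(tau_mirror hi); rewrite !tauK. Qed.

(** By oddness a descent of w^0 in the left half reflects to one in the right half, so every descent
    of w^0 comes from a generator; [i = 0] is the central one. *)
Lemma descent_mirror n f u : odd_fun n f -> u.+1 < n.*2 -> (f u.+1 < f u)%R ->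
  exists i, [/\ i < n, (f (n + i)%N < f (n + i - 1)%N)%R & (u.+1 = n + i \/ u.+1 + i = n)].
Proof.
move=> od hu hd; case: (leqP n u.+1) => h.
  exists (u.+1 - n); have -> : n + (u.+1 - n) = u.+1 by lia.
  by rewrite subn1; split; [lia| |left].
exists (n - u.+1); have -> : n + (n - u.+1) - 1 = n.*2 - u.+2 by lia.
have -> : n + (n - u.+1) = n.*2 - u.+1 by lia.
have e1 := od u.+1 (n.*2 - u.+2) ltac:(lia).
have e2 := od u (n.*2 - u.+1) ltac:(lia).
by split; [lia| |right]; lia.
Qed.

(** Swapping [u, u.+1] and the opposite pair keeps the order of all other pairs of positions. The
    triple therefore survives at its new positions unless two of its neighbouring entries form a
    swapped pair, which the last four hypotheses exclude. *)
Lemma free_triple_below n f u p q r : odd_fun n f -> u.+1 < n.*2 -> (f u.+1 < f u)%R ->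
  p < q -> q < r -> r < n.*2 -> (f q < f p)%R -> (f r < f q)%R ->
  (p + q).+1 <> n.*2 -> (p + r).+1 <> n.*2 -> (q + r).+1 <> n.*2 ->
  ~ (p = u /\ q = u.+1) -> ~ (q = u /\ r = u.+1) ->
  ~ (p + u.+2 = n.*2 /\ q = p.+1) -> ~ (q + u.+2 = n.*2 /\ r = q.+1) ->
  bad_below n f.
Proof.
move=> od hu hd pq qr rn fpq fqr npq npr nqr c1 c2 c3 c4.
have [i [hi di ui]] := descent_mirror od hu hd.
exists i; split=> //; right; exists (tau n i p), (tau n i q), (tau n i r).
have ti a b : a < b -> ~ (a = u /\ b = u.+1) -> ~ (a + u.+2 = n.*2 /\ b = a.+1) ->
    tau n i a < tau n i b.
  clear - hi ui hu => ab d1 d2; apply: tau_lt => //; lia.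
rewrite /= !tauK //; split=> //; split; try exact: tau_nmirror; try exact: ltn_tau.
  apply: ti => // -[e1 e2]; apply: c3; split=> //; lia.
apply: ti => // -[e1 e2]; apply: c4; split=> //; lia.
Qed.

(** Besides the swapped pair, the case [i = u.+1 = n] is excluded because [s_0] would move the
    negative entry out of the window. *)
Lemma neg_pair_below n f u i j : odd_fun n f -> n <= u.+1 -> u.+1 < n.*2 -> (f u.+1 < f u)%R ->
  n <= i -> i < j -> j < n.*2 -> (f i < 0)%R -> (f j < f i)%R ->
  ~ (i = u /\ j = u.+1) -> ~ (i = u.+1 /\ i = n) -> bad_below n f.
Proof.
move=> od nu hu hd ni ij jn fi fj c1 c2.
have [k [hk dk uk]] := descent_mirror od hu hd.
exists k; split=> //; left; exists (tau n k i), (tau n k j).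
rewrite /= !tauK //; split=> //; try exact: ltn_tau.
  clear - ni ij c2 uk hk nu; apply: tau_ge => // -[]; lia.
clear - ni ij c1 uk hk nu; apply: tau_lt => //; lia.
Qed.

Lemma ex_descent (f : nat -> int) a b : a < b -> (f b < f a)%R ->
  exists u, [/\ a <= u, u < b & (f u.+1 < f u)%R].
Proof.
elim: b => // b IH; rewrite ltnS leq_eqVlt => /orP[/eqP->|ab] hf; first by exists b.
case: (ltP (f b.+1) (f b)) => h; first by exists b; split=> //; lia.
by have [|u [h1 h2 h3]] := IH ab; [lia|exists u; split=> //; lia].
Qed.

Lemma neg_pair_step n f : odd_fun n f -> inj_fun n f -> neg_pair n f ->
  adj_bad n f \/ bad_below n f.
Proof.
move=> od ij [i [j []]] ni.
move: {2}(j - i) (leqnn (j - i)) => d.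
elim: d j => [|d IH] j dj ltij jn fi fj; first by lia.
(* A pair not starting at [n] survives the removal of [s_0] if [f n < 0], and otherwise that of a
   descent met between [n] and [i]. *)
have [ein|nin] := eqVneq i n; last first.
  right; case: (ltP (f n) 0%R) => fn.
    apply: (@neg_pair_below _ _ n.-1 i j) => //; try lia.
    have -> : n.-1.+1 = n by lia.
    rewrite (od n.-1 n) in fn *; lia.
  have [||u [h1 h2 h3]] := @ex_descent f n i; try lia.
  by apply: (@neg_pair_below _ _ u i j) => //; lia.
subst i.
have [ej|nj] := eqVneq j n.+1.
  by left; left; subst j; split=> //; lia.
(* Either the step from [j.-1] to [j] descends and can be removed, or [j.-1] replaces [j]. *)
have e : j.-1.+1 = j by lia.
case: (ltP (f j) (f j.-1)) => h.
  right; apply: (@neg_pair_below _ _ j.-1 n j) => //; rewrite ?e; lia.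
apply: (IH j.-1); try lia.
Qed.


Lemma free_triple_mirror n f p q r : odd_fun n f ->
  p < q -> q < r -> r < n.*2 -> (f q < f p)%R -> (f r < f q)%R ->
  (f (n.*2 - q.+1)%N < f (n.*2 - r.+1)%N)%R /\ (f (n.*2 - p.+1)%N < f (n.*2 - q.+1)%N)%R.
Proof.
move=> od pq qr rn fpq fqr.
rewrite (od p (n.*2 - p.+1)); last lia.
rewrite (od q (n.*2 - q.+1)); last lia.
rewrite (od r (n.*2 - r.+1)); last lia.
by split; lia.
Qed.

(** Here [p.+1] cannot replace [p], being opposite to [r]. Removing the descent at [p.+1], [p.+2]
    makes the same three values reappear at [p], [p.+1] and the opposite of [p.+2], where no two
    positions are opposite. *)
Lemma tight_triple_step n f p q r : odd_fun n f -> q = p.+2 -> (p.+1 + r).+1 = n.*2 ->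
  q < r -> (f q < f p)%R -> (f r < f q)%R -> (f p < f p.+1)%R -> bad_below n f.
Proof.
move=> od eq er qr fpq fqr fm.
have hd : (f p.+2 < f p.+1)%R by rewrite -eq; lia.
have hu : p.+2 < n.*2 by lia.
have [i [hi di ui]] := descent_mirror od hu hd.
exists i; split=> //; right; exists p, p.+1, (n.*2 - q.+1) => /=.
have -> : tau n i p = p by clear - hi ui eq er qr; rewrite /tau; eqn_cases; lia.
have -> : tau n i p.+1 = q by clear - hi ui eq er qr; rewrite /tau; eqn_cases; lia.
have -> : tau n i (n.*2 - q.+1) = r by clear - hi ui eq er qr; rewrite /tau; eqn_cases; lia.
by split; split; lia.
Qed.

(** If [f] descends from [p] to [p.+1], this descent can be removed without touching the triple.
    Otherwise [p.+1] may replace [p], which shortens the triple; the work lies in the cases where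
    [p.+1] is opposite to [q] or [r]. *)
Lemma gap_triple_step n f d : odd_fun n f -> inj_fun n f ->
  (forall p q r, r - p <= d -> p < q -> q < r -> r < n.*2 ->
    (f q < f p)%R -> (f r < f q)%R ->
    (p + q).+1 <> n.*2 -> (p + r).+1 <> n.*2 -> (q + r).+1 <> n.*2 ->
    adj_bad n f \/ bad_below n f) ->
  forall p q r, r - p <= d.+1 -> p.+1 < q -> q < r -> r < n.*2 ->
    (f q < f p)%R -> (f r < f q)%R ->
    (p + q).+1 <> n.*2 -> (p + r).+1 <> n.*2 -> (q + r).+1 <> n.*2 ->
    adj_bad n f \/ bad_below n f.
Proof.
move=> od ij IH p q r dpr pq qr rn fpq fqr npq npr nqr.
case: (ltP (f p.+1) (f p)) => fm.
  right; apply: (@free_triple_below n f p p q r) => //; lia.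
have {}fm : (f p < f p.+1)%R.
  rewrite lt_neqAle fm andbT; apply/eqP => /ij; lia.
(* If [q] is opposite to [p.+1], then [f q < f p.+1 = - f q], so [f q] is negative and [q] lies in
   the right half. *)
have [eqm|nqm] := eqVneq (p.+1 + q).+1 n.*2.
  apply: neg_pair_step => //; exists q, r; split=> //; try lia.
  have := od _ _ eqm; lia.
have [erm|nrm] := eqVneq (p.+1 + r).+1 n.*2; last first.
  by apply: (IH p.+1 q r) => //; lia.
have fr := od _ _ erm.
have [eq|nq] := eqVneq q p.+2; first by right; apply: (@tight_triple_step n f p q r).
have er : r.-1.+1 = r by lia.
(* Now [r] is opposite to [p.+1], and the right end is moved instead. If there is no room, [q] is
   opposite to [p.+2], whose value is compared with [f p]. *)
have [eqr|nq'] := eqVneq q r.-1; last first.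
  case: (ltP (f r) (f r.-1)) => h.
    right; apply: (@free_triple_below n f r.-1 p q r) => //; rewrite ?er; lia.
  have [e|ne] := eqVneq (q + r.-1).+1 n.*2; first lia.
  apply: (IH p q r.-1); lia.
have fq := od q p.+2; have {}fq := fq ltac:(lia).
case: (ltP (f p.+2) (f p)) => hp; first by right; apply: (@tight_triple_step n f p p.+2 r) => //; lia.
apply: neg_pair_step => //; exists q, r; split=> //; lia.
Qed.

Lemma free_triple_step n f : odd_fun n f -> inj_fun n f -> free_triple n f ->
  adj_bad n f \/ bad_below n f.
Proof.
move=> od ij [p [q [r [[pq qr rn] [fpq fqr] [npq npr nqr]]]]].
move: {2}(r - p) (leqnn (r - p)) => d dpr.
elim: d p q r dpr pq qr rn fpq fqr npq npr nqr => [|d IH] p q r dpr pq qr rn fpq fqr npq npr nqr.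
  by lia.
have [e1|ne1] := eqVneq q p.+1; last by apply: (gap_triple_step od ij IH (p := p) (q := q) (r := r)); lia.
(* A gap between [q] and [r] becomes a gap after the first entry of the mirrored triple. *)
have [h1 h2] := free_triple_mirror od pq qr rn fpq fqr.
have [e2|ne2] := eqVneq r q.+1; last first.
  by apply: (gap_triple_step od ij IH (p := n.*2 - r.+1) (q := n.*2 - q.+1) (r := n.*2 - p.+1)); lia.
(* Three consecutive positions, no two of them opposite, avoid the centre, so the triple or its
   mirror image lies in the window. *)
subst; left; right; case: (leqP n p) => hp; first by exists p; split.
exists (n.*2 - p.+3).
have -> : (n.*2 - p.+3).+2 = n.*2 - p.+1 by lia.
have -> : (n.*2 - p.+3).+1 = n.*2 - p.+2 by lia.
by split; lia.
Qed.

Lemma bad_step n f : odd_fun n f -> inj_fun n f -> bad n f -> adj_bad n f \/ bad_below n f.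
Proof. by move=> od ij [/neg_pair_step|/free_triple_step]; apply. Qed.

Lemma adj_bad_bad n f : odd_fun n f -> adj_bad n f -> bad n f.
Proof.
move=> od [[h1 h2 h3]|[i [h1 h2 h3 h4]]].
  by left; exists n, n.+1; split=> //; lia.
by right; exists i, i.+1, i.+2; split; split=> //; lia.
Qed.

(** [tau] carries a pattern of [f \o tau n i] back to [f]: it reverses only the swapped pairs, on
    which [f \o tau n i] increases. For [i = 0] the entry at [n] is positive after the removal, so
    it cannot start a negative pair. *)
Lemma bad_below_bad n f : odd_fun n f -> bad_below n f -> bad n f.
Proof.
move=> od [i [hi hd]].
have t p : p < n.*2 -> tau n i p < n.*2 by exact: ltn_tau.
have hd' := od (n + i) (n - i - 1); have {}hd' := hd' ltac:(lia).
have hd2 := od (n + i - 1) (n - i); have {}hd2 := hd2 ltac:(lia).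
case=> [[a [b []]]|[p [q [r [[pq qr rn] [/= h1 h2] [n1 n2 n3]]]]]].
- move=> /= na ab bn fa fb.
  have [[ea eb]|ne] : (a = n + i - 1 /\ b = n + i) \/ tau n i a < tau n i b.
    have [ea|na'] := eqVneq a (n + i - 1); last by right; apply: tau_lt => //; lia.
    have [eb|nb] := eqVneq b (n + i); first by left.
    by right; apply: tau_lt => //; lia.
  - have et : tau n i a = n + i by rewrite ea; clear - hi; rewrite /tau; eqn_cases; lia.
    have et' : tau n i b = n + i - 1 by rewrite eb; clear - hi; rewrite /tau; eqn_cases; lia.
    by move: fb; rewrite et et'; lia.
  - case: (leqP n (tau n i a)) => h; first by left; exists (tau n i a), (tau n i b); split=> //; exact: t.
    have ea : a = n /\ i = 0 by clear - h na hi; move: h; rewrite /tau; eqn_cases; lia.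
    case: ea => ? ?; subst.
    have et : tau n 0 n = n.-1 by rewrite /tau; eqn_cases; lia.
    by move: fa fb hd hd2; rewrite et !addn0 subn1 subn0; lia.
- right; exists (tau n i p), (tau n i q), (tau n i r).
  have lt a b : a < b -> (f (tau n i b) < f (tau n i a))%R -> tau n i a < tau n i b.
    move=> ab fab.
    have [[ea eb]|ne] : (a = n + i - 1 /\ b = n + i) \/ ~ (a = n + i - 1 /\ b = n + i) by lia.
      suff : False by []; move: fab hd; subst a b; rewrite /tau eqxx.
      rewrite ifF; [rewrite eqxx; lia|lia].
    have [[ea eb]|ne'] : (a = n - i - 1 /\ b = n - i) \/ ~ (a = n - i - 1 /\ b = n - i) by lia.
      have ta : tau n i a = n - i by rewrite ea; clear - hi; rewrite /tau; eqn_cases; lia.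
      have tb : tau n i b = n - i - 1 by rewrite eb; clear - hi; rewrite /tau; eqn_cases; lia.
      by move: fab; rewrite ta tb; lia.
    exact: tau_lt.
  split; [|by []|].
    by split; [exact: lt|exact: lt|exact: t].
  by split; apply: tau_nmirror.
Qed.

(** * Fully commutative elements *)

Definition sym_fun (w : seq int) (p : nat) : int := nth 0%R (w0 w) p.

Lemma size_w0 w : size (w0 w) = (size w).*2.
Proof. by rewrite /w0 size_cat size_map size_rev addnn. Qed.

Lemma sym_fun_pos w j : sym_fun w (size w + j) = nth 0%R w j.
Proof.
rewrite /sym_fun /w0 nth_cat size_map size_rev ifF; last by rewrite ltnNge leq_addr.
by rewrite addKn.
Qed.

Lemma sym_fun_neg w p : p < size w -> sym_fun w p = (- nth 0 w (size w - p.+1)%N)%R.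
Proof.
by move=> pn; rewrite /sym_fun /w0 nth_cat size_map size_rev pn (nth_map 0%R) ?size_rev // nth_rev.
Qed.

Lemma sym_fun_odd w : odd_fun (size w) (sym_fun w).
Proof.
move=> p q e; case: (ltnP p (size w)) => h.
  have -> : q = size w + (size w - p.+1) by lia.
  by rewrite sym_fun_pos sym_fun_neg // opprK.
have -> : p = size w + (size w - q.+1) by lia.
by rewrite sym_fun_pos sym_fun_neg //; lia.
Qed.

Lemma size_act_gen w i : i < size w -> size (act_gen w i) = size w.
Proof.
move=> hi; rewrite /act_gen; case: eqP => [ei|_]; rewrite !size_set_nth; lia.
Qed.

Lemma nth_act_gen w i j : nth 0%R (act_gen w i) j =
  if i == 0 then if j == 0 then (- nth 0 w 0%N)%R else nth 0%R w j
  else if j == i then nth 0%R w i.-1 else if j == i.-1 then nth 0%R w i else nth 0%R w j.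
Proof. by rewrite /act_gen; case: eqP => _; rewrite !nth_set_nth /= ?nth_set_nth. Qed.

Lemma sym_fun_act w i p : i < size w -> p < (size w).*2 ->
  sym_fun (act_gen w i) p = sym_fun w (tau (size w) i p).
Proof.
move=> hi; have sz := size_act_gen hi.
have pos j : sym_fun (act_gen w i) (size w + j) = sym_fun w (tau (size w) i (size w + j)).
  rewrite -{1}sz sym_fun_pos nth_act_gen.
  have [i0|i0] := eqVneq i 0.
    have [j0|j0] := eqVneq j 0.
      have -> : tau (size w) i (size w + j) = size w - 1 by rewrite /tau; eqn_cases; lia.
      by rewrite sym_fun_neg; last lia; congr (- nth _ _ _)%R; lia.
    have -> : tau (size w) i (size w + j) = size w + j by rewrite /tau; eqn_cases; lia.
    by rewrite sym_fun_pos.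
  have [->|ji] := eqVneq j i.
    have -> : tau (size w) i (size w + i) = size w + i.-1 by rewrite /tau; eqn_cases; lia.
    by rewrite sym_fun_pos.
  have [ji'|ji'] := eqVneq j i.-1.
    have -> : tau (size w) i (size w + j) = size w + i by rewrite /tau; eqn_cases; lia.
    by rewrite sym_fun_pos.
  have -> : tau (size w) i (size w + j) = size w + j by rewrite /tau; eqn_cases; lia.
  by rewrite sym_fun_pos.
move=> pn; case: (leqP (size w) p) => h; first by rewrite -(subnKC h) pos.
have e : ((size w + (size w - p.+1)) + p).+1 = (size w).*2 by lia.
have od := @sym_fun_odd (act_gen w i); rewrite sz in od.
by rewrite (od _ _ e) (sym_fun_odd (tau_mirror hi e)) pos.
Qed.

Definition descent (w : seq int) (i : nat) : bool :=
  if i == 0 then (nth 0 w 0%N < 0)%R else (nth 0 w i < nth 0 w i.-1)%R.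

Lemma sym_fun_descent w i : i < size w ->
  (sym_fun w (size w + i)%N < sym_fun w (size w + i - 1)%N)%R = descent w i.
Proof.
move=> hi; rewrite /descent sym_fun_pos; case: eqP => [->|i0].
  rewrite addn0 sym_fun_neg; last lia.
  have -> : size w - (size w - 1).+1 = 0 by lia.
  by lia.
have -> : size w + i - 1 = size w + i.-1 by lia.
by rewrite sym_fun_pos.
Qed.

Lemma act_gen0 x B : act_gen (x :: B) 0 = (- x)%R :: B. Proof. by []. Qed.

Lemma act_genS A x y B i : i = (size A).+1 -> act_gen (A ++ x :: y :: B) i = A ++ y :: x :: B.
Proof.
move=> ->; apply: (@eq_from_nth _ 0%R) => [|j _].
  by rewrite size_act_gen !size_cat //=; lia.
rewrite nth_act_gen /= !nth_cat ltnn subnn ltnNge leqnSn /= subSnn /=.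
have [->|j1] := eqVneq j (size A).+1; first by rewrite ltnNge leqnSn subSnn.
have [->|j2] := eqVneq j (size A); first by rewrite ltnn subnn.
by case: ltnP => // h; have -> : j - size A = (j - size A).-2.+2 by lia.
Qed.

Lemma descent0 x B : descent (x :: B) 0 = (x < 0)%R. Proof. by []. Qed.

Lemma descentS A x y B i : i = (size A).+1 -> descent (A ++ x :: y :: B) i = (y < x)%R.
Proof. by move=> ->; rewrite /descent /= !nth_cat ltnn subnn ltnNge leqnSn subSnn. Qed.

Lemma act_gen_decomp (w : seq int) i : 0 < i -> i < size w ->
  exists A x y B, w = A ++ x :: y :: B /\ i = (size A).+1.
Proof.
move=> i0 hi; exists (take i.-1 w), (nth 0%R w i.-1), (nth 0%R w i), (drop i.+1 w).
rewrite size_take; case: ltnP => h; last lia.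
split; last lia.
rewrite -{1}(cat_take_drop i.-1 w) (drop_nth 0%R) //; congr (_ ++ _ :: _).
have -> : i.-1.+1 = i by lia.
by rewrite (drop_nth 0%R).
Qed.

Lemma act_genK w i : i < size w -> act_gen (act_gen w i) i = w.
Proof.
case: (posnP i) => [->|i0] hi; first by case: w hi => // x B _; rewrite !act_gen0 opprK.
by have [A [x [y [B [-> ei]]]]] := act_gen_decomp i0 hi; rewrite !act_genS.
Qed.

Lemma descent_act w i : i < size w -> 0%R \notin w -> uniq w -> descent (act_gen w i) i = ~~ descent w i.
Proof.
case: (posnP i) => [->|i0] hi.
  case: w hi => // x B _; rewrite inE negb_or act_gen0 !descent0 => /andP[h _] _; lia.
have [A [x [y [B [-> ei]]]]] := act_gen_decomp i0 hi; rewrite act_genS // !descentS // => _.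
rewrite cat_uniq => /and3P[_ _ /= /andP[]]; rewrite inE negb_or => /andP[xy _] _; lia.
Qed.

Lemma signed_perm_act n w i : i < n -> signed_perm n w -> signed_perm n (act_gen w i).
Proof.
move=> hi [sz hp]; split; first by rewrite size_act_gen ?sz.
apply: perm_trans hp; rewrite -sz in hi.
case: (posnP i) => [e|i0]; first by subst i; case: w hi {sz} => //= x B _; rewrite abszN.
have [A [x [y [B [-> ei]]]]] := act_gen_decomp i0 hi; rewrite act_genS // !map_cat perm_cat2l /=.
by apply/permP => P /=; lia.
Qed.

Lemma signed_perm_uniq_abs n w : signed_perm n w -> uniq (map absz w).
Proof. by case=> _ h; rewrite (perm_uniq h) iota_uniq. Qed.

Lemma signed_perm_uniq n w : signed_perm n w -> uniq w.
Proof. by move/signed_perm_uniq_abs/map_uniq. Qed.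

Lemma signed_perm_neq0 n w : signed_perm n w -> 0%R \notin w.
Proof.
case=> _ h; apply/negP => h0; have : 0 \in map absz w by apply/mapP; exists 0%R.
by rewrite (perm_mem h) mem_iota.
Qed.

(** A letter common to both halves would put [x] and [- x] in [w]; equal absolute values force equal
    positions, hence [x = 0]. *)
Lemma uniq_w0 n w : signed_perm n w -> uniq (w0 w).
Proof.
move=> sp; rewrite /w0 cat_uniq map_inj_uniq; last exact: oppr_inj.
rewrite rev_uniq (signed_perm_uniq sp) /= andbT; apply/hasPn => x xw.
apply/negP => /mapP[y]; rewrite mem_rev => yw e.
have ua := signed_perm_uniq_abs sp; have n0 := signed_perm_neq0 sp.
have ix := index_mem x w; have iy := index_mem y w; rewrite xw in ix; rewrite yw in iy.
have : index x w = index y w.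
  apply/eqP; rewrite -(nth_uniq 0 _ _ ua) ?size_map //.
  by rewrite !(nth_map 0%R) // !nth_index // e abszN.
move=> ei; have exy : x = y by rewrite -(nth_index 0%R xw) ei nth_index.
have x0 : x = 0%R by lia.
by rewrite x0 in xw; rewrite xw in n0.
Qed.

Lemma sym_fun_inj n w : signed_perm n w -> inj_fun n (sym_fun w).
Proof.
move=> sp p q; have [sz _] := sp; rewrite -sz -size_w0 => hp hq /eqP.
by rewrite /sym_fun nth_uniq ?(uniq_w0 sp) // => /eqP.
Qed.

(** * Coxeter length and reduced words *)

Fixpoint inv (s : seq int) : nat :=
  if s is x :: s' then count (fun y : int => y < x)%R s' + inv s' else 0.

Fixpoint nsp (s : seq int) : nat :=
  if s is x :: s' then (x < 0)%R + count (fun y : int => x + y < 0)%R s' + nsp s' else 0.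

(* Coxeter length of type B: inversions plus negative sums [w_i + w_j] with [i <= j]. *)
Definition len (w : seq int) : nat := inv w + nsp w.

(** For [i = 0], negating the first entry exchanges its inversions with its negative sums with later
    entries, and only its own sign is lost. For [i > 0], negative sums do not depend on the order of
    the entries. *)
Lemma len_act w i : i < size w -> descent w i -> len w = (len (act_gen w i)).+1.
Proof.
case: (posnP i) => [->|i0] hi.
  case: w hi => // x B _; rewrite act_gen0 descent0 /len /= => x0.
  have e1 : count (fun y : int => y < - x)%R B = count (fun y : int => x + y < 0)%R B.
    by apply: eq_count => y /=; lia.
  have e2 : count (fun y : int => - x + y < 0)%R B = count (fun y : int => y < x)%R B.
    by apply: eq_count => y /=; lia.
  rewrite e1 e2 x0; have -> : (- x < 0)%R = false by lia.
  by rewrite /=; lia.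
have [A [x [y [B [-> ei]]]]] := act_gen_decomp i0 hi; rewrite act_genS // descentS // => yx.
rewrite /len; have -> : nsp (A ++ x :: y :: B) = nsp (A ++ y :: x :: B).
  elim: A {hi ei} => [|a A IH] /=; last by rewrite IH !count_cat /=; lia.
  by rewrite [(y + x)%R]addrC; lia.
suff -> : inv (A ++ x :: y :: B) = (inv (A ++ y :: x :: B)).+1 by [].
elim: A {hi ei} => [|a A IH] /=; last by rewrite IH !count_cat /=; lia.
have -> : (x < y)%R = false by lia.
by rewrite yx /=; lia.
Qed.

Lemma len_act_asc n w i : signed_perm n w -> i < n -> ~~ descent w i ->
  len (act_gen w i) = (len w).+1.
Proof.
move=> sp hi nd; have [sz _] := sp; rewrite -sz in hi.
have sp' := signed_perm_act (i := i) _ sp.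
rewrite (@len_act (act_gen w i) i) ?size_act_gen ?act_genK //.
by rewrite descent_act // ?(signed_perm_neq0 sp) // (signed_perm_uniq sp).
Qed.

Lemma no_descent n w : signed_perm n w -> (forall i, i < n -> ~~ descent w i) -> w = id_signed n.
Proof.
move=> sp nd; have [sz hp] := sp.
have srt : sorted (fun x y : int => x < y)%R w.
  apply/(sortedP 0%R) => i hi; have := nd i.+1; rewrite -sz => /(_ hi); rewrite /descent /= -leNgt le_eqVlt.
  by case/orP => // /eqP /uniqP; rewrite !inE => h; have := h (signed_perm_uniq sp) (ltnW hi) hi; lia.
have pos x : x \in w -> (0 < x)%R.
  case: w sz hp srt sp nd => // a w sz hp srt sp nd.
  have a0 : (0 < a)%R.
    have := nd 0; rewrite -sz /= => /(_ isT); rewrite descent0; have := signed_perm_neq0 sp.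
    by rewrite inE; lia.
  rewrite inE => /orP[/eqP ->|] //.
  move/(order_path_min (@lt_trans _ _)): srt => /allP h /h; apply: lt_trans a0.
have ew : w = map Posz (map absz w).
  rewrite -map_comp -{1}[w]map_id; apply/eq_in_map => x /pos /=; lia.
rewrite ew /id_signed; congr map.
apply: (@irr_sorted_eq _ ltn) => //; [exact: ltn_trans|exact: ltnn| |exact: iota_ltn_sorted|exact: perm_mem].
rewrite ew sorted_map in srt.
by apply: sub_sorted srt => a b /=.
Qed.

Lemma signed_perm_id n : signed_perm n (id_signed n).
Proof. by split; rewrite /id_signed ?size_map ?size_iota // -map_comp (eq_map (g := id)) ?map_id. Qed.

Lemma len_id n : len (id_signed n) = 0.
Proof.
rewrite /id_signed; move: 1 => m; rewrite /len; elim: n m => //= n IH m.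
have := IH m.+1.
have e1 : count (fun y : int => y < m)%R [seq Posz i | i <- iota m.+1 n] = 0.
  by apply/eqP; rewrite -leqn0 leqNgt -has_count; apply/hasPn => y /mapP[i]; rewrite mem_iota => ? ->; lia.
have e2 : count (fun y : int => m%:Z + y < 0)%R [seq Posz i | i <- iota m.+1 n] = 0.
  by apply/eqP; rewrite -leqn0 leqNgt -has_count; apply/hasPn => y /mapP[i]; rewrite mem_iota => ? ->; lia.
by rewrite e1 e2; lia.
Qed.

Lemma eval_rcons n a i : eval_word n (rcons a i) = act_gen (eval_word n a) i.
Proof. by rewrite /eval_word foldl_rcons. Qed.

Lemma word_rcons n a i : word_of n (rcons a i) = (i < n) && word_of n a.
Proof. exact: all_rcons. Qed.

Lemma eval_word_spec n a : word_of n a -> signed_perm n (eval_word n a) /\ len (eval_word n a) <= size a.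
Proof.
elim/last_ind: a => [|a i IH]; first by split; [exact: signed_perm_id|rewrite len_id].
rewrite word_rcons eval_rcons size_rcons => /andP[hi /IH [sp hl]].
split; first exact: signed_perm_act.
have [d|d] := boolP (descent (eval_word n a) i); last by rewrite (len_act_asc sp hi d).
by have [sz _] := sp; rewrite -sz in hi; have := len_act hi d; lia.
Qed.

Lemma ex_reduced_word n w : signed_perm n w -> exists a, [/\ word_of n a, eval_word n a = w & size a = len w].
Proof.
move e: (len w) => l; elim: l w e => [|l IH] w e sp.
all: have [/existsP[i d]|] := boolP [exists i : 'I_n, descent w i].
1,3: have [sz _] := sp; have hi : i < size w by rewrite sz.
- by have := len_act hi d; lia.
- have [|a [h1 h2 h3]] := IH (act_gen w i) _ (signed_perm_act (ltn_ord i) sp).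
    by have := len_act hi d; lia.
  exists (rcons a i); rewrite word_rcons ltn_ord h1 eval_rcons h2 act_genK // size_rcons h3; split=> //.
all: rewrite negb_exists => /forallP nd; have ew : w = id_signed n by apply: (no_descent sp) => i hi; exact: (nd (Ordinal hi)).
- by exists [::]; rewrite ew.
- by rewrite ew len_id in e.
Qed.

Lemma reducedE n w a : signed_perm n w ->
  reduced n w a <-> [/\ word_of n a, eval_word n a = w & size a = len w].
Proof.
move=> sp; split=> [[h1 [h2 h3]]|[h1 h2 h3]].
  split=> //; apply/eqP; rewrite eqn_leq; have [_] := eval_word_spec h1; rewrite h2 => -> /=.
  by rewrite andbT; have [b [b1 b2 <-]] := ex_reduced_word sp; apply: h3.
split=> //; split=> // b b1 b2; rewrite h3 -b2; by have [] := eval_word_spec b1.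
Qed.

(** * Commutation classes and braid relations *)

Lemma act_gen_comm w i j : i < size w -> j < size w -> commuting i j ->
  act_gen (act_gen w i) j = act_gen (act_gen w j) i.
Proof.
move=> hi hj c; apply: (@eq_from_nth _ 0%R) => [|k _]; first by rewrite !size_act_gen // size_act_gen.
move: c; rewrite /commuting !nth_act_gen; eqn_cases => //; lia.
Qed.

Lemma descent_act_comm w i j : i < size w -> j < size w -> commuting i j ->
  descent (act_gen w i) j = descent w j.
Proof. by move=> hi hj; rewrite /commuting /descent !nth_act_gen; eqn_cases => //; lia. Qed.

(** The letters [k] and [k.+1] do not commute, so a commutation moves at most one letter of this
    subword. *)
Lemma comm_equiv_filter a b k : comm_equiv a b ->
  filter (fun j => (j == k) || (j == k.+1)) a = filter (fun j => (j == k) || (j == k.+1)) b.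
Proof.
elim=> {a b} [a b [u v i j]|//|a b c _ -> _ -> //]; rewrite /commuting => cij.
by rewrite !filter_cat /=; congr (_ ++ _); case: ifP; case: ifP => //; lia.
Qed.

Lemma comm_equiv_rcons a b i : comm_equiv a b -> comm_equiv (rcons a i) (rcons b i).
Proof.
elim=> {a b} [a b [u v x y h]|a|a b c _ h1 _ h2].
- by apply: rt_step; rewrite -!cats1 -!catA /=; apply: CommStep.
- exact: rt_refl.
- exact: rt_trans h2.
Qed.

Lemma comm_equiv_swap a i j : commuting i j -> comm_equiv (rcons (rcons a i) j) (rcons (rcons a j) i).
Proof. by move=> c; apply: rt_step; rewrite -!cats1 -!catA /=; apply: CommStep. Qed.

Lemma reduced_rcons n w a i : signed_perm n w -> reduced n w (rcons a i) ->
  [/\ i < n, descent w i & reduced n (act_gen w i) a].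
Proof.
move=> sp /(reducedE _ sp) []; rewrite word_rcons eval_rcons size_rcons => /andP[hi wa] ew hl.
have [spa la] := eval_word_spec wa; have [sza _] := spa.
have hia : i < size (eval_word n a) by rewrite sza.
have ea : eval_word n a = act_gen w i by rewrite -ew act_genK.
have spw : signed_perm n (act_gen w i) := signed_perm_act hi sp.
have d : descent w i.
  by apply/negPn/negP => nd; have := len_act_asc sp hi nd; rewrite -ea; lia.
have [sz _] := sp; have := len_act _ d; rewrite sz => /(_ hi) e.
by split=> //; apply/reducedE => //; split=> //; lia.
Qed.

Lemma rcons_reduced n w a i : signed_perm n w -> i < n -> descent w i ->
  reduced n (act_gen w i) a -> reduced n w (rcons a i).
Proof.
move=> sp hi d /(reducedE _ (signed_perm_act hi sp)) [h1 h2 h3]; apply/reducedE => //.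
have [sz _] := sp; have hi' : i < size w by rewrite sz.
by rewrite word_rcons hi h1 eval_rcons h2 act_genK // size_rcons h3 -len_act.
Qed.

Lemma bad_act n w i : signed_perm n w -> i < n ->
  bad n (sym_fun (act_gen w i)) <-> bad n (sym_fun w \o tau n i).
Proof.
move=> [sz _] hi; subst n.
have e p : p < (size w).*2 -> sym_fun (act_gen w i) p = (sym_fun w \o tau (size w) i) p.
  by move=> hp; rewrite sym_fun_act.
split=> -[[a [b [h1 h2 h3 h4 h5]]]|[p [q [r [[h1 h2 h3] [h4 h5] h6]]]]].
- by left; exists a, b; rewrite -!e //; lia.
- by right; exists p, q, r; rewrite -!e //; lia.
- by left; exists a, b; rewrite !e //; lia.
- by right; exists p, q, r; rewrite !e //; lia.
Qed.

Lemma good_act n w i : signed_perm n w -> i < n -> descent w i ->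
  ~ bad n (sym_fun w) -> ~ bad n (sym_fun (act_gen w i)).
Proof.
move=> sp hi d g /(bad_act sp hi) b; apply: g; have [sz _] := sp; subst n.
apply: bad_below_bad; first exact: sym_fun_odd.
by exists i; rewrite sym_fun_descent.
Qed.

Lemma adj_bad_descent n w i : signed_perm n w -> i.+1 < n -> descent w i -> descent w i.+1 ->
  bad n (sym_fun w).
Proof.
move=> [sz _] hi; rewrite -sz in hi *; move=> d1 d2; apply: adj_bad_bad; first exact: sym_fun_odd.
have := sym_fun_descent (ltnW hi); have := sym_fun_descent hi; rewrite d1 d2 => h2 h1.
case: (posnP i) => [i0|i0]; [left|right].
  subst i; split=> //; move: d1 d2; rewrite /descent /= => d1 d2.
    by rewrite -[X in sym_fun _ X]addn0 sym_fun_pos.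
  by rewrite -[X in (_ < sym_fun _ X)%R]addn0 -[X in sym_fun _ X.+1]addn0 -addnS !sym_fun_pos.
exists (size w + i - 1).
have e1 : (size w + i - 1).+1 = size w + i by lia.
rewrite e1 -addnS; split; try lia.
by have -> : size w + i = size w + i.+1 - 1 by lia.
Qed.

Lemma good_fully_commutative n w : signed_perm n w -> ~ bad n (sym_fun w) -> fully_commutative n w.
Proof.
move e: (len w) => l; elim: l w e => [|l IH] w e sp g a b ra rb.
  have := ra; have := rb; move=> /(reducedE _ sp) [_ _ +] /(reducedE _ sp) [_ _].
  by rewrite e; case: a {ra}; case: b {rb} => // *; exact: rt_refl.
have [sz _] := sp.
have IHi i a' b' : i < n -> descent w i -> reduced n (act_gen w i) a' -> reduced n (act_gen w i) b' ->
    comm_equiv a' b'.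
  move=> hi d; apply: IH; [|exact: signed_perm_act|exact: good_act].
  by have := len_act _ d; rewrite sz => /(_ hi); lia.
case/lastP: a ra => [|a i]; first by move=> /(reducedE _ sp) [_ _]; rewrite e.
case/lastP: b rb => [|b j]; first by move=> /(reducedE _ sp) [_ _]; rewrite e.
move=> /(reduced_rcons sp) [hj dj rb] /(reduced_rcons sp) [hi di ra].
have [ij|nij] := eqVneq i j.
  by subst j; apply: comm_equiv_rcons; apply: (IHi i).
(* Distinct generators that do not commute are neighbours, and two neighbouring descents form a
   pattern. *)
have [c|nc] := boolP (commuting i j); last first.
  case: g; move: nc; rewrite /commuting => nc.
  have [eij|eij] : i = j.+1 \/ j = i.+1 by lia.
    by subst i; apply: (adj_bad_descent (i := j)).
  by subst j; apply: (adj_bad_descent (i := i)).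
have c' : commuting j i by move: c; rewrite /commuting orbC.
have hi' : i < size w by rewrite sz.
have hj' : j < size w by rewrite sz.
have spi := signed_perm_act hi sp; have spj := signed_perm_act hj sp.
(* The two words are linked through [v j i] and [v i j], where [v] is a reduced word of
   [w s_i s_j]. *)
have [v [v1 v2 v3]] := ex_reduced_word (signed_perm_act hj spi).
have rv : reduced n (act_gen (act_gen w i) j) v by apply/reducedE => //; exact: signed_perm_act.
have rvj : reduced n (act_gen w i) (rcons v j) by apply: rcons_reduced => //; rewrite descent_act_comm.
have rvi : reduced n (act_gen w j) (rcons v i).
  by apply: rcons_reduced => //; rewrite ?descent_act_comm // -act_gen_comm.
apply: rt_trans (comm_equiv_rcons i (IHi i _ _ hi di ra rvj)) _.
apply: rt_trans (comm_equiv_swap v c') _.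
exact: comm_equiv_rcons (IHi j _ _ hj dj rvi rb).
Qed.

(** The failure is recorded through the commutation invariant, because a difference of these
    subwords persists when the same letter is appended to both words. *)
Definition braided (n : nat) (w : seq int) : Prop := exists a b k,
  [/\ reduced n w a, reduced n w b &
      filter (fun j => (j == k) || (j == k.+1)) a <> filter (fun j => (j == k) || (j == k.+1)) b].

Lemma braided_not_fc n w : braided n w -> ~ fully_commutative n w.
Proof. by move=> [a [b [k [ra rb ne]]]] fc; apply: ne; apply: comm_equiv_filter; apply: fc. Qed.

Lemma braided_act n w i : signed_perm n w -> i < n -> descent w i ->
  braided n (act_gen w i) -> braided n w.
Proof.
move=> sp hi d [a [b [k [ra rb ne]]]]; exists (rcons a i), (rcons b i), k; split.
- exact: rcons_reduced.
- exact: rcons_reduced.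
- by rewrite !filter_rcons; case: ifP => // _ /rcons_inj [].
Qed.

Lemma adj_bad_braided n w : signed_perm n w -> adj_bad n (sym_fun w) -> braided n w.
Proof.
move=> sp; have [sz _] := sp.
case=> [[n1 f0 f1]|[i [ni i2 f1 f2]]].
  have [x [y [B ew]]] : exists x y B, w = x :: y :: B.
    by move: n1; rewrite -sz; case: (w) => [|x [|y B]] // _; exists x, y, B.
  have x0 : (x < 0)%R by move: f0; rewrite -[X in sym_fun _ X]addn0 -sz sym_fun_pos ew.
  have yx : (y < x)%R.
    move: f1; rewrite -[X in (_ < sym_fun _ X)%R]addn0 -[X in sym_fun _ X.+1]addn0 -addnS -sz.
    by rewrite !sym_fun_pos ew.
  (* [v] is the shortest element of the coset of [w] under [s_0, s_1]; both sides of the braid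
     relation of length 4 lead from [v] to [w]. *)
  set v : seq int := (- x)%R :: (- y)%R :: B.
  have e1 : act_gen (act_gen (act_gen (act_gen v 0) 1) 0) 1 = w.
    by rewrite /v ew /act_gen /= !opprK.
  have e2 : act_gen (act_gen (act_gen (act_gen v 1) 0) 1) 0 = w.
    by rewrite /v ew /act_gen /= !opprK.
  have spv : signed_perm n v.
    case: sp => _; rewrite ew => hp; split; first by rewrite -sz ew.
    by rewrite /v /= !abszN.
  have lv : len w = len v + 4.
    have h (s t : seq int) i : i < size s -> descent s i -> act_gen s i = t -> len s = (len t).+1.
      by move=> hi hd <-; exact: len_act.
    rewrite ew (h _ [:: (- x)%R, y & B] 0) // (h _ [:: y, (- x)%R & B] 1) ?/descent //=; last lia.
    rewrite (h _ [:: (- y)%R, (- x)%R & B] 0) ?/descent //=; last lia.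
    by rewrite (h _ v 1) ?/descent //=; lia.
  have [a [a1 a2 a3]] := ex_reduced_word spv.
  exists (a ++ [:: 0; 1; 0; 1]), (a ++ [:: 1; 0; 1; 0]), 0; split.
  - apply/reducedE => //; split.
    + by rewrite /word_of all_cat [all _ a]a1 /= n1 (ltnW n1).
    + by rewrite /eval_word foldl_cat [foldl _ _ a]a2.
    + by rewrite size_cat a3 lv.
  - apply/reducedE => //; split.
    + by rewrite /word_of all_cat [all _ a]a1 /= n1 (ltnW n1).
    + by rewrite /eval_word foldl_cat [foldl _ _ a]a2.
    + by rewrite size_cat a3 lv.
  - by rewrite !filter_cat /= => /eqP; rewrite eqseq_cat // eqxx.
have [A [x [y [z [B [ew ei]]]]]] : exists A x y z B, w = A ++ [:: x, y, z & B] /\ i = n + size A.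
  exists (take (i - n) w), (nth 0%R w (i - n)), (nth 0%R w (i - n).+1), (nth 0%R w (i - n).+2), (drop (i - n).+3 w).
  rewrite -!drop_nth ?cat_take_drop ?size_take; try lia.
  by split=> //; case: ifP; lia.
have nth1 j : sym_fun w (n + j) = nth 0%R w j by rewrite -sz sym_fun_pos.
have nthA j : nth 0%R w (j + size A) = nth 0%R [:: x, y, z & B] j.
  by rewrite ew nth_cat ltnNge leq_addl addnK.
have yx : (y < x)%R.
  by move: f1; rewrite ei -addnS !nth1 (nthA 1) (nthA 0).
have zy : (z < y)%R.
  by move: f2; rewrite ei -!addnS !nth1 (nthA 1) (nthA 2).
pose k := (size A).+1.
have e21 C c d D : act_gen (A ++ C :: c :: d :: D) k.+1 = A ++ C :: d :: c :: D.
  by rewrite -(cat_rcons C A (c :: d :: D)) -(cat_rcons C A (d :: c :: D)) act_genS // size_rcons.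
have e10 c d D : act_gen (A ++ c :: d :: D) k = A ++ d :: c :: D by rewrite act_genS.
have d21 C c d D : descent (A ++ C :: c :: d :: D) k.+1 = (d < c)%R.
  by rewrite -(cat_rcons C A (c :: d :: D)) descentS // size_rcons.
have d10 c d D : descent (A ++ c :: d :: D) k = (d < c)%R by rewrite descentS.
have kn : k.+1 < n by rewrite -sz ew size_cat /= /k; lia.
(* The same for [s_k, s_{k+1}]: sorting [x > y > z] removes three descents, in either of two
   orders. *)
set v := A ++ [:: z, y, x & B].
have spv : signed_perm n v.
  case: sp; rewrite ew => s1 hp; split; first by rewrite -s1 /v !size_cat.
  by apply: perm_trans hp; rewrite /v !map_cat perm_cat2l; apply/permP => P /=; lia.
have lv : len w = len v + 3.
  have szk D : size D = 3 + size B -> k.+1 < size (A ++ D) by rewrite size_cat => ->; rewrite /k; lia.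
  rewrite ew (@len_act _ k) ?d10 ?e10 //; last by apply: ltnW; apply: szk.
  rewrite (@len_act _ k.+1) ?d21 ?e21 //; [|exact: szk|lia].
  rewrite (@len_act _ k) ?d10 ?e10 //; last by apply: ltnW; apply: szk.
  by rewrite /v; lia.
have [a [a1 a2 a3]] := ex_reduced_word spv.
exists (a ++ [:: k; k.+1; k]), (a ++ [:: k.+1; k; k.+1]), k; split.
- apply/reducedE => //; split.
  + by rewrite /word_of all_cat [all _ a]a1 /= kn (ltnW kn).
  + by rewrite /eval_word foldl_cat [foldl _ _ a]a2 /= /v e10 e21 e10 ew.
  + by rewrite size_cat a3 lv.
- apply/reducedE => //; split.
  + by rewrite /word_of all_cat [all _ a]a1 /= kn (ltnW kn).
  + by rewrite /eval_word foldl_cat [foldl _ _ a]a2 /= /v e21 e10 e21 ew.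
  + by rewrite size_cat a3 lv.
- rewrite !filter_cat /= !eqxx /= !orbT /= => /eqP; rewrite eqseq_cat // eqxx /= eqseq_cons; case: eqP => //; lia.
Qed.

Lemma bad_braided n w : signed_perm n w -> bad n (sym_fun w) -> braided n w.
Proof.
move e: (len w) => l; elim: l w e => [|l IH] w e sp b; have [sz _] := sp.
all: have od := @sym_fun_odd w; rewrite sz in od.
all: have [|[i [hi d b']]] := bad_step od (sym_fun_inj sp) b; first exact: adj_bad_braided.
all: rewrite -{1 2}sz sym_fun_descent ?sz // in d; have := len_act _ d; rewrite sz => /(_ hi) el.
  by rewrite e in el.
apply: (braided_act sp hi d); apply: IH; [lia|exact: signed_perm_act|exact/(bad_act sp hi)].
Qed.

Theorem fully_commutativeE n w : signed_perm n w ->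
  fully_commutative n w <-> ~ bad n (sym_fun w).
Proof.
move=> sp; split; last exact: good_fully_commutative.
by move=> fc b; apply: braided_not_fc fc; apply: bad_braided.
Qed.

(** * Greene's theorem for columns *)

Definition gti : rel int := fun x y => (y < x)%R.

Definition proj (c : nat) (cs : seq (int * nat)) : seq int :=
  [seq x.1 | x <- cs & x.2 == c].

Definition coloured (k : nat) (cs : seq (int * nat)) : nat := count (fun x => x.2 < k) cs.

(* Colours below [k] are the [k] disjoint decreasing subsequences; other colours mark unused letters. *)
Definition k_decreasing (k m : nat) (s : seq int) : Prop :=
  exists cs, [/\ map fst cs = s, forall c, c < k -> pairwise gti (proj c cs) & m <= coloured k cs].

(** The contexts [u], [v] make this a congruence for concatenation, so that Knuth moves may be
    applied inside a word. *)
Definition equi_dec (s t : seq int) : Prop :=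
  forall k m u v, k_decreasing k m (u ++ s ++ v) <-> k_decreasing k m (u ++ t ++ v).

Lemma equi_dec_trans s t r : equi_dec s t -> equi_dec t r -> equi_dec s r.
Proof. by move=> h1 h2 k m u v; rewrite h1. Qed.

Lemma equi_dec_sym s t : equi_dec s t -> equi_dec t s.
Proof. by move=> h k m u v; rewrite h. Qed.

Lemma equi_dec_cat a s t b : equi_dec s t -> equi_dec (a ++ s ++ b) (a ++ t ++ b).
Proof. by move=> h k m u v; have := h k m (u ++ a) (b ++ v); rewrite -!catA. Qed.

Lemma equi_dec_catl a s t : equi_dec s t -> equi_dec (a ++ s) (a ++ t).
Proof. by move=> h; have := equi_dec_cat a [::] h; rewrite !cats0. Qed.

Lemma equi_dec_catr s t b : equi_dec s t -> equi_dec (s ++ b) (t ++ b).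
Proof. exact: (@equi_dec_cat [::]). Qed.

Lemma proj_cat c a b : proj c (a ++ b) = proj c a ++ proj c b.
Proof. by rewrite /proj filter_cat map_cat. Qed.

Lemma proj_cons c x i a : proj c ((x, i) :: a) = if i == c then x :: proj c a else proj c a.
Proof. by rewrite /proj /=; case: eqP. Qed.

Definition cswap (c d i : nat) : nat := if i == c then d else if i == d then c else i.

(** Applied to the tail of a word, this exchanges the tails of two subsequences. *)
Definition recolour (c d : nat) (cs : seq (int * nat)) := [seq (x.1, cswap c d x.2) | x <- cs].

Lemma proj_recolour c d e cs : proj e (recolour c d cs) = proj (cswap c d e) cs.
Proof.
elim: cs => // -[x i] cs IH; rewrite [recolour _ _ _]/= !proj_cons IH.
by congr (if _ then _ else _); rewrite /cswap; eqn_cases; lia.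
Qed.

Lemma coloured_recolour k c d cs : c < k -> d < k -> coloured k (recolour c d cs) = coloured k cs.
Proof.
move=> ck dk; elim: cs => // -[x i] cs IH /=; rewrite /coloured /= in IH *; rewrite IH; congr (_ + _).
by rewrite /cswap; have [->|_] := eqVneq i c; [|have [->|_] := eqVneq i d]; rewrite ?ck ?dk.
Qed.

Lemma map_fst_recolour c d cs : map fst (recolour c d cs) = map fst cs.
Proof. by rewrite /recolour -map_comp; apply: eq_map. Qed.

Lemma coloured_cat k a b : coloured k (a ++ b) = coloured k a + coloured k b.
Proof. exact: count_cat. Qed.

Lemma map_fst_split (cs : seq (int * nat)) u s v : map fst cs = u ++ s ++ v ->
  exists a b c, [/\ cs = a ++ b ++ c, map fst a = u, map fst b = s & map fst c = v].
Proof.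
move=> e; exists (take (size u) cs), (take (size s) (drop (size u) cs)), (drop (size s) (drop (size u) cs)).
by rewrite !cat_take_drop !map_take !map_drop e take_size_cat // drop_size_cat // take_size_cat // drop_size_cat.
Qed.

Definition below (x : int) (s : seq int) : bool := all (fun y => y < x)%R s.
Definition above (x : int) (s : seq int) : bool := all (fun y => x < y)%R s.

Lemma below_trans x y s : (x < y)%R -> below x s -> below y s.
Proof. by move=> xy /allP h; apply/allP => z /h /lt_trans; apply. Qed.

Lemma above_trans x y s : (y < x)%R -> above x s -> above y s.
Proof. by move=> xy /allP h; apply/allP => z /h; apply: lt_trans. Qed.

Lemma pairwise_pivot a y b :
  pairwise gti (a ++ y :: b) = [&& above y a, below y b, pairwise gti a & pairwise gti b].
Proof.
rewrite pairwise_cat /= allrel_consr; have -> : all (gti^~ y) a = above y a by [].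
have -> : all (gti y) b = below y b by [].
case ya: (above y a) => //=; case yb: (below y b) => //=; last by rewrite !andbF.
have -> : allrel gti a b; last by [].
apply/allrelP => s t /(allP ya) h1 /(allP yb) h2; exact: lt_trans h2 h1.
Qed.

(* Exchanging the tails of the subsequences through [y] and through [x], [z] repairs the
   subsequence that used both [z] and [x]. *)
Lemma k_decreasing_knuth1 k m u v (x y z : int) : (x < y)%R -> (y < z)%R ->
  k_decreasing k m (u ++ [:: y; z; x] ++ v) -> k_decreasing k m (u ++ [:: y; x; z] ++ v).
Proof.
move=> xy yz; have xz := lt_trans xy yz; move=> [cs [/map_fst_split [a [b [c [-> ea + ec]]]] hd hm]].
case: b hd hm => [//|[y' d] [//|[z' i] [//|[x' j] [|//]]]] hd hm [? ? ?]; subst y' z' x'.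
have [eij|nij] := eqVneq i j; last first.
  exists (a ++ [:: (y, d); (x, j); (z, i)] ++ c); split; first by rewrite !map_cat /= ea ec.
    move=> e ek; have := hd e ek; rewrite !proj_cat !proj_cons.
    have [?|_] := eqVneq i e; have [?|_] := eqVneq j e => //; subst.
    by rewrite eqxx in nij.
  by move: hm; rewrite !coloured_cat /coloured /=; lia.
subst j; have [ik|ik] := ltnP i k; last first.
  exists (a ++ [:: (y, d); (x, i); (z, i)] ++ c); split; first by rewrite !map_cat /= ea ec.
    move=> e ek; have := hd e ek; rewrite !proj_cat !proj_cons.
    by have [?|_] := eqVneq i e => //; subst; rewrite leqNgt ek in ik.
  by move: hm; rewrite !coloured_cat /coloured /=; lia.
(* [y] and [z] ascend, so they cannot lie in the same subsequence. *)
have nid : d != i.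
  apply/eqP => ?; subst d; have := hd i ik.
  rewrite !proj_cat !proj_cons eqxx /= pairwise_pivot /= => /and5P[_ /andP[h _] _ _ _]; lia.
have := hd i ik; rewrite !proj_cat !proj_cons eqxx (negbTE nid) /= pairwise_pivot /=.
move=> /and4P[za /andP[_ zc] pa /andP[xc pc]].
have nid' : (i == d) = false by rewrite eq_sym (negbTE nid).
have [dk|dk] := ltnP d k.
  have := hd d dk; rewrite !proj_cat !proj_cons eqxx nid' /= pairwise_pivot.
  move=> /and4P[ya yc pa' pc'].
  exists (a ++ [:: (y, d); (x, d); (z, i)] ++ recolour d i c); split.
  - by rewrite !map_cat map_fst_recolour /= ea ec.
  - move=> e ek; have := hd e ek.
    rewrite !proj_cat !proj_cons proj_recolour /cswap.
    have [->|ned] := eqVneq e d.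
      by move=> _; rewrite ?eqxx ?nid' ?(negbTE nid) /= pairwise_pivot /= xy ya (below_trans xy xc) pa' xc pc.
    have [->|nei] := eqVneq e i.
      by move=> _; rewrite ?eqxx ?(negbTE nid) ?nid' /= pairwise_pivot za (below_trans yz yc) pa pc'.
    by [].
  - by move: hm; rewrite !coloured_cat coloured_recolour // /coloured /=; lia.
exists (a ++ [:: (y, i); (x, i); (z, d)] ++ c); split.
- by rewrite !map_cat /= ea ec.
- move=> e ek; have := hd e ek; rewrite !proj_cat !proj_cons.
  have -> : (d == e) = false by lia.
  have [<- _|nei //] := eqVneq i e.
  by rewrite /= pairwise_pivot /= xy (above_trans yz za) (below_trans xy xc) pa xc pc.
- by move: hm; rewrite !coloured_cat /coloured /=; lia.
Qed.

(** An ascending pair never shares a used colour, so each letter keeps its colour. This is the easy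
    direction of both Knuth moves. *)
Lemma k_decreasing_asc k m u v (x z : int) : (x < z)%R ->
  k_decreasing k m (u ++ [:: x; z] ++ v) -> k_decreasing k m (u ++ [:: z; x] ++ v).
Proof.
move=> xz [cs [/map_fst_split [a [b [c [-> ea + ec]]]] hd hm]].
case: b hd hm => [//|[x' i] [//|[z' j] [|//]]] hd hm [? ?]; subst z' x'.
exists (a ++ [:: (z, j); (x, i)] ++ c); split; first by rewrite !map_cat /= ea ec.
  move=> e ek; have := hd e ek; rewrite !proj_cat !proj_cons.
  have [?|_] := eqVneq i e; have [?|_] := eqVneq j e => //; subst.
  by rewrite pairwise_pivot /= => /and5P[_ /andP[h _] _ _ _]; lia.
by move: hm; rewrite !coloured_cat /coloured /=; lia.
Qed.

Lemma k_decreasing_knuth2 k m u v (x y z : int) : (x < y)%R -> (y < z)%R ->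
  k_decreasing k m (u ++ [:: z; x; y] ++ v) -> k_decreasing k m (u ++ [:: x; z; y] ++ v).
Proof.
move=> xy yz; have xz := lt_trans xy yz; move=> [cs [/map_fst_split [a [b [c [-> ea + ec]]]] hd hm]].
case: b hd hm => [//|[z' i] [//|[x' j] [//|[y' d] [|//]]]] hd hm [? ? ?]; subst y' z' x'.
have [eij|nij] := eqVneq i j; last first.
  exists (a ++ [:: (x, j); (z, i); (y, d)] ++ c); split; first by rewrite !map_cat /= ea ec.
    move=> e ek; have := hd e ek; rewrite !proj_cat !proj_cons.
    have [?|_] := eqVneq i e; have [?|_] := eqVneq j e => //; subst.
    by rewrite eqxx in nij.
  by move: hm; rewrite !coloured_cat /coloured /=; lia.
subst j; have [ik|ik] := ltnP i k; last first.
  exists (a ++ [:: (x, i); (z, i); (y, d)] ++ c); split; first by rewrite !map_cat /= ea ec.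
    move=> e ek; have := hd e ek; rewrite !proj_cat !proj_cons.
    by have [?|_] := eqVneq i e => //; subst; rewrite leqNgt ek in ik.
  by move: hm; rewrite !coloured_cat /coloured /=; lia.
have nid : d != i.
  apply/eqP => ?; subst d; have := hd i ik.
  rewrite !proj_cat !proj_cons eqxx /= pairwise_pivot /= => /and4P[_ _ _ /andP[/andP[]]]; rewrite /gti; lia.
have := hd i ik; rewrite !proj_cat !proj_cons eqxx (negbTE nid) /= pairwise_pivot /=.
move=> /and4P[za /andP[_ zc] pa /andP[xc pc]].
have nid' : (i == d) = false by rewrite eq_sym (negbTE nid).
have [dk|dk] := ltnP d k.
  have := hd d dk; rewrite !proj_cat !proj_cons eqxx nid' /= pairwise_pivot.
  move=> /and4P[ya yc pa' pc'].
  exists (a ++ [:: (x, d); (z, i); (y, i)] ++ recolour d i c); split.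
  - by rewrite !map_cat map_fst_recolour /= ea ec.
  - move=> e ek; have := hd e ek.
    rewrite !proj_cat !proj_cons proj_recolour /cswap.
    have [->|ned] := eqVneq e d.
      by move=> _; rewrite ?eqxx ?nid' ?(negbTE nid) /= pairwise_pivot; apply/and4P; split=> //; exact: above_trans ya.
    have [->|nei] := eqVneq e i.
      by move=> _; rewrite ?eqxx ?(negbTE nid) ?nid' /= pairwise_pivot; apply/and4P; split=> //=; [rewrite yz; exact: below_trans yc|apply/andP].
    by [].
  - by move: hm; rewrite !coloured_cat coloured_recolour // /coloured /=; lia.
exists (a ++ [:: (x, d); (z, i); (y, i)] ++ c); split.
- by rewrite !map_cat /= ea ec.
- move=> e ek; have := hd e ek; rewrite !proj_cat !proj_cons.
  have -> : (d == e) = false by lia.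
  have [<- _|nei //] := eqVneq i e.
  have yc := below_trans xy xc.
  by rewrite /= pairwise_pivot; apply/and4P; split=> //=; [rewrite yz; exact: below_trans yc|apply/andP].
- by move: hm; rewrite !coloured_cat /coloured /=; lia.
Qed.

Lemma knuth1 (x y z : int) : (x < y)%R -> (y < z)%R -> equi_dec [:: y; z; x] [:: y; x; z].
Proof.
move=> xy yz k m u v; split; first exact: k_decreasing_knuth1.
have h := @k_decreasing_asc k m (u ++ [:: y]) v x z (lt_trans xy yz).
by rewrite -!catA in h; exact: h.
Qed.

Lemma knuth2 (x y z : int) : (x < y)%R -> (y < z)%R -> equi_dec [:: z; x; y] [:: x; z; y].
Proof.
move=> xy yz k m u v; split; first exact: k_decreasing_knuth2.
exact: (@k_decreasing_asc k m u (y :: v) x z (lt_trans xy yz)).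
Qed.

(** * Row insertion by Knuth moves *)

Definition lti : rel int := fun x y => (x < y)%R.

Lemma bump_rowP (r : seq int) (x : int) : x \notin r ->
  (below x r /\ bump_row r x = (rcons r x, None)) \/
  exists (r1 : seq int) (y : int) (r2 : seq int), [/\ r = r1 ++ y :: r2, below x r1, (x < y)%R &
                     bump_row r x = (r1 ++ x :: r2, Some y)].
Proof.
elim: r => [|y r IH] /=; first by left.
rewrite inE negb_or => /andP[xy xr]; case: (ltP x y) => h.
  by right; exists [::], y, r.
have yx : (y < x)%R by rewrite lt_neqAle h eq_sym xy.
case: (IH xr) => [[hb ->]|[r1 [z [r2 [-> hb xz ->]]]]]; first by left; rewrite yx.
by right; exists (y :: r1), z, r2; rewrite /= yx.
Qed.

(** [x] passes the entries of [r] from right to left. The entry preceding the one that is passed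
    lies between the two in value and permits the move. *)
Lemma knuth_slide_right y r x : pairwise lti (y :: r) -> (x < y)%R ->
  equi_dec (y :: rcons r x) [:: y, x & r].
Proof.
elim: r y => [|t r IH] y // /andP[] /= /andP[yt _] tr xy.
have h1 := equi_dec_catl [:: y] (IH t tr (lt_trans xy yt)).
exact: equi_dec_trans h1 (equi_dec_catr r (knuth1 xy yt)).
Qed.

(** The bumped [y] passes the entries of [r] from right to left; passing [b] is permitted by the
    entry that follows [b], which is [x] the first time. *)
Lemma knuth_slide_left r y x s : pairwise lti r -> below x r -> (x < y)%R ->
  equi_dec (r ++ [:: y, x & s]) (y :: r ++ x :: s).
Proof.
elim: r => [|b r IH] // /andP[br pr] /andP[bx rx] xy.
have h1 := equi_dec_catl [:: b] (IH pr rx xy).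
apply: equi_dec_trans h1 _ => /=; have byy := lt_trans bx xy.
case: r rx br {IH pr} => [|c r] rx br /=; first exact: equi_dec_catr (equi_dec_sym (knuth2 bx xy)).
case/andP: rx => cx _; case/andP: br => bc _.
exact: (equi_dec_catr (r ++ x :: s) (equi_dec_sym (knuth2 bc (lt_trans cx xy)))).
Qed.

Lemma equi_dec_bump r1 y r2 x : pairwise lti (r1 ++ y :: r2) -> below x r1 -> (x < y)%R ->
  equi_dec (rcons (r1 ++ y :: r2) x) (y :: r1 ++ x :: r2).
Proof.
rewrite pairwise_cat => /and3P[_ p1 p2] hb xy; rewrite rcons_cat /=.
exact: equi_dec_trans (equi_dec_catl r1 (knuth_slide_right p2 xy)) (knuth_slide_left _ p1 hb xy).
Qed.

Definition dom (r s : seq int) : Prop :=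
  size s <= size r /\ forall j, j < size s -> (nth 0%R r j < nth 0%R s j)%R.

Fixpoint tableau (t : seq (seq int)) : Prop :=
  if t is r :: t' then [/\ 0 < size r, pairwise lti r, dom r (head [::] t') & tableau t'] else True.

(** Lower rows come first: a bumped entry, moved to the front of its row, then stands right after
    the rows into which it is inserted. *)
Definition reading (t : seq (seq int)) : seq int := flatten (rev t).

Lemma reading_cons r t : reading (r :: t) = reading t ++ r.
Proof. by rewrite /reading rev_cons flatten_rcons. Qed.

Lemma pairwise_replace r1 y r2 x : pairwise lti (r1 ++ y :: r2) -> below x r1 -> (x < y)%R ->
  pairwise lti (r1 ++ x :: r2).
Proof.
rewrite !pairwise_cat /= !allrel_consr => /and4P[/andP[_ a12] p1 yr p2] hb xy.
rewrite a12 p1 p2 !andbT /= ; apply/andP; split; first exact: hb.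
by apply/allP => z /(allP yr); apply: lt_trans.
Qed.

Lemma nth_replace_le (r1 r2 : seq int) (x y : int) j : (x < y)%R -> (nth 0%R (r1 ++ x :: r2) j <= nth 0%R (r1 ++ y :: r2) j)%R.
Proof.
move=> xy; rewrite !nth_cat; case: ltnP => // _.
by case: (j - size r1) => //=; apply: ltW.
Qed.

Lemma nth_below x r j : below x r -> j < size r -> (nth 0%R r j < x)%R.
Proof. by move=> /allP h hj; apply: h; apply: mem_nth. Qed.

(** If [s] has an entry in column [size r1], it exceeds [y]. So [y] lands weakly left of the column
    it came from, under an entry that is at most [x]. *)
Lemma dom_bump r1 y r2 x s : pairwise lti (r1 ++ y :: r2) -> below x r1 -> (x < y)%R ->
  dom (r1 ++ y :: r2) s -> y \notin s -> dom (r1 ++ x :: r2) (bump_row s y).1.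
Proof.
move=> pr hb xy [hs hd] ys.
have hy : below y r1 by exact: below_trans xy hb.
have szr : size (r1 ++ x :: r2) = size (r1 ++ y :: r2) by rewrite !size_cat.
have at_le j : j <= size r1 -> (nth 0%R (r1 ++ x :: r2) j < y)%R.
  rewrite leq_eqVlt => /orP[/eqP->|jr]; first by rewrite nth_cat ltnn subnn.
  by rewrite nth_cat jr; apply: nth_below.
have aty : nth 0%R (r1 ++ y :: r2) (size r1) = y by rewrite nth_cat ltnn subnn.
have le_small c : below y c -> (forall j, j < size c -> (nth 0%R (r1 ++ y :: r2) j < nth 0%R c j)%R) -> size c <= size r1.
  move=> bc h; rewrite leqNgt; apply/negP => lt.
  by have := h _ lt; have := nth_below bc lt; rewrite aty; lia.
case: (bump_rowP ys) => [[sb ->]|[c [z [d [es cb yz ->]]]]] /=.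
  have sl := le_small s sb hd.
  split; first by rewrite szr size_rcons size_cat /=; lia.
  move=> j; rewrite size_rcons ltnS nth_rcons leq_eqVlt => /orP[/eqP->|js].
    by rewrite ltnn eqxx; apply: at_le.
  by rewrite js; apply: le_lt_trans (hd j js); apply: nth_replace_le.
subst s; have cl : size c <= size r1.
  apply: le_small => // j jc; have := hd j; rewrite [nth 0%R (c ++ _) _]nth_cat jc; apply.
  by rewrite size_cat /=; lia.
split; first by rewrite szr; move: hs; rewrite !size_cat.
move=> j js; have [->|nj] := eqVneq j (size c).
  by rewrite [X in (_ < X)%R]nth_cat ltnn subnn /=; apply: at_le.
have -> : nth 0%R (c ++ y :: d) j = nth 0%R (c ++ z :: d) j.
  rewrite !nth_cat; case: ltnP => // h.
  case E: (j - size c) => [|i] //; move/eqP: E; rewrite subn_eq0 => E; by rewrite eqn_leq E h in nj.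
apply: le_lt_trans (hd j _); first exact: nth_replace_le.
by move: js; rewrite !size_cat.
Qed.

Lemma head_row_insert t x : head [::] (row_insert t x) = (bump_row (head [::] t) x).1.
Proof. by case: t => [|r t] //=; case: (bump_row r x) => [r' [y|]]. Qed.

Lemma mem_head_flatten (x : int) (t : seq (seq int)) : x \in head [::] t -> x \in flatten t.
Proof. by case: t => //= r t h; rewrite mem_cat h. Qed.

Lemma row_insert_spec t x : tableau t -> uniq (flatten t) -> x \notin flatten t ->
  [/\ tableau (row_insert t x), perm_eq (flatten (row_insert t x)) (x :: flatten t) &
      equi_dec (rcons (reading t) x) (reading (row_insert t x))].
Proof.
elim: t x => [|r t IH] x; first by split=> //; split=> //; split.
move=> [r0 pr hd tt]; rewrite [flatten _]/= mem_cat cat_uniq negb_or.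
move=> /and3P[ur urt ut] /andP[xr xt].
case: (bump_rowP xr) => [[hb e]|[r1 [y [r2 [er hb xy e]]]]].
  rewrite /= e; split.
  - split=> //; first by rewrite size_rcons.
      by rewrite pairwise_rcons pr andbT; exact: hb.
    case: hd => hs hd; split; first by rewrite size_rcons; lia.
    by move=> j js; rewrite nth_rcons (leq_trans js hs); apply: hd.
  - by rewrite /= -cats1 -catA /= perm_sym -cat1s perm_catCA.
  - by rewrite !reading_cons rcons_cat.
have yt : y \notin flatten t.
  by apply/negP => h; move/hasPn: urt => /(_ y h); rewrite er mem_cat mem_head orbT.
have [t1 t2 t3] := IH y tt ut yt; rewrite /= e; split.
- split=> //; first by rewrite size_cat addnS.
    by rewrite er in pr; apply: pairwise_replace pr hb xy.
  rewrite head_row_insert; apply: dom_bump; rewrite -?er //.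
  by apply/negP => /mem_head_flatten h; rewrite h in yt.
- rewrite er /= -!catA /= perm_sym -cat1s perm_catCA perm_cat2l /= perm_cons.
  by rewrite -cat1s perm_catCA perm_cat2l perm_sym.
- rewrite !reading_cons rcons_cat er.
  rewrite er in pr; have h1 := equi_dec_catl (reading t) (equi_dec_bump pr hb xy).
  apply: equi_dec_trans h1 _; rewrite -cat_rcons; exact: equi_dec_catr.
Qed.

Lemma RSK_P_rcons s x : RSK_P (rcons s x) = row_insert (RSK_P s) x.
Proof. by rewrite /RSK_P -cats1 foldl_cat. Qed.

Lemma RSK_P_spec s : uniq s ->
  [/\ tableau (RSK_P s), perm_eq (flatten (RSK_P s)) s & equi_dec s (reading (RSK_P s))].
Proof.
elim/last_ind: s => [|s x IH]; first by split.
rewrite rcons_uniq => /andP[xs us]; have [h1 h2 h3] := IH us.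
rewrite RSK_P_rcons; have [||t1 t2 t3] := @row_insert_spec (RSK_P s) x h1.
- by rewrite (perm_uniq h2).
- by rewrite (perm_mem h2).
split=> //; first by apply: (perm_trans t2); rewrite perm_sym perm_rcons perm_cons perm_sym.
by apply: equi_dec_trans t3; rewrite -!cats1; apply: equi_dec_catr.
Qed.

(** * Columns of a tableau *)

Lemma proj_zip_iota c m r : proj c (zip r (iota m (size r))) =
  if (m <= c) && (c < m + size r) then [:: nth 0%R r (c - m)] else [::].
Proof.
elim: r m => [|x r IH] m /=; first by rewrite addn0 ltnNge andbN.
rewrite proj_cons IH; have [->|nc] := eqVneq m c.
  by rewrite subnn ltnn leqnn addnS ltnS leq_addr.
case: ifP; case: ifP; rewrite ?addnS //; try lia.
by move=> _ h; have -> : c - m = (c - m.+1).+1 by lia.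
Qed.

Lemma coloured_zip_iota k r : coloured k (zip r (iota 0 (size r))) = minn k (size r).
Proof.
have -> : coloured k (zip r (iota 0 (size r))) = count (fun i => i < k) (iota 0 (size r)).
  by rewrite -[X in count _ X](@unzip2_zip _ _ r) ?size_iota // count_map.
elim: (size r) => [|n IH]; first by rewrite minn0.
by rewrite -addn1 iotaD count_cat IH /=; lia.
Qed.

(* The number of cells in the first [k] columns. *)
Definition greene (k : nat) (lam : seq nat) : nat := \sum_(a <- lam) minn k a.

(** Each cell is coloured by its column; the reading word runs up the columns, so every colour
    decreases. The third clause is the invariant that allows a new first row to be put on top. *)
Lemma tableau_columns t : tableau t -> exists cs, [/\ map fst cs = reading t,
  (forall c, pairwise gti (proj c cs)),
  (forall c x, x \in proj c cs -> c < size (head [::] t) /\ (nth 0%R (head [::] t) c <= x)%R) &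
  forall k, coloured k cs = greene k (map size t)].
Proof.
elim: t => [|r t IH] /=; first by exists [::]; split=> // k; rewrite /greene big_nil.
case=> _ pr [hs hd] /IH [cs [e1 e2 e3 e4]].
exists (cs ++ zip r (iota 0 (size r))); split.
- by rewrite map_cat e1 reading_cons -[map fst (zip _ _)]/(unzip1 _) unzip1_zip ?size_iota.
- move=> c; rewrite proj_cat proj_zip_iota /= add0n subn0; case: ifP => cr; last by rewrite cats0.
  rewrite pairwise_pivot /= e2 !andbT; apply/allP => x /e3 [cs' h].
  by apply: lt_le_trans h; apply: hd.
- move=> c x; rewrite proj_cat proj_zip_iota /= add0n subn0 mem_cat => /orP[/e3 [h1 h2]|].
    by split; [lia|apply: ltW; apply: lt_le_trans h2; apply: hd].
  by case: ifP => cr //; rewrite inE => /eqP ->.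
- by move=> k; rewrite coloured_cat coloured_zip_iota e4 /greene big_cons addnC.
Qed.

Lemma coloured_row k (cs : seq (int * nat)) : pairwise lti (map fst cs) ->
  (forall c, c < k -> pairwise gti (proj c cs)) -> coloured k cs <= k.
Proof.
move=> pl; elim: k => [|k IH] hc.
  by rewrite /coloured (eq_count (a2 := pred0)) ?count_pred0.
have -> : coloured k.+1 cs = coloured k cs + size (proj k cs).
  rewrite /proj size_map size_filter /coloured.
  elim: cs {IH hc pl} => //= a cs ->; rewrite ltnS leq_eqVlt.
  by case: (ltngtP a.2 k) => /=; lia.
have h1 := hc k (ltnSn k); have {}IH := IH (fun c ck => hc c (ltnW ck)).
have h2 : pairwise lti (proj k cs).
  by apply: subseq_pairwise pl; apply: map_subseq; apply: filter_subseq.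
suff : size (proj k cs) <= 1 by lia.
case: (proj k cs) h1 h2 => [|x [|y l]] //= /andP[/andP[h _] _] /andP[/andP[h' _] _].
by move: h h'; rewrite /gti /lti; lia.
Qed.

Lemma greene_reading_le t k m : tableau t -> k_decreasing k m (reading t) -> m <= greene k (map size t).
Proof.
move=> tt [cs [e hc hm]]; apply: leq_trans hm _.
elim: t tt cs e hc => [|r t IH] /=.
  by move=> _ [|//] _ _; rewrite /coloured.
move=> [_ pr _ tt] cs; rewrite reading_cons => e hc.
have := @map_fst_split cs (reading t) r [::]; rewrite cats0 => /(_ e) [a [b [c [ecs ea eb ec]]]].
case: c ecs ec => // ecs _; rewrite cats0 in ecs; subst cs.
rewrite coloured_cat /greene big_cons addnC leq_add //.
  rewrite leq_min; apply/andP; split.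
    apply: coloured_row; rewrite ?eb // => i ik; have := hc i ik.
    by rewrite proj_cat pairwise_cat => /and3P[].
  by rewrite -eb size_map /coloured count_size.
apply: IH => // i ik; have := hc i ik.
by rewrite proj_cat pairwise_cat => /and3P[].
Qed.

(** Knuth invariance reduces [s] to the reading word. There the columns attain the bound, and it
    cannot be exceeded because an increasing row meets each decreasing subsequence at most once. *)
Theorem greene_columns s k m : uniq s ->
  k_decreasing k m s <-> m <= greene k (map size (RSK_P s)).
Proof.
move=> us; have [tt _ eq] := RSK_P_spec us.
have := eq k m [::] [::]; rewrite /= !cats0 => ->; split; first exact: greene_reading_le.
have [cs [e1 e2 _ e4]] := tableau_columns tt.
by move=> hm; exists cs; split=> //; rewrite e4.
Qed.

(** * The first row and decreasing triples *)

Definition incr (f : nat -> int) : rel nat := fun p q => (p < q) && (f p < f q)%R.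

Lemma bump_row_at (r : seq int) (x : int) : pairwise lti r -> x \notin r ->
  exists i, [/\ i <= size r, size (bump_row r x).1 = maxn (size r) i.+1,
    forall j, nth 0%R (bump_row r x).1 j = if j == i then x else nth 0%R r j,
    forall j, j < i -> (nth 0%R r j < x)%R &
    forall j, i <= j -> j < size r -> (x < nth 0%R r j)%R].
Proof.
move=> pr xr; case: (bump_rowP xr) => [[hb ->]|[r1 [y [r2 [er hb xy ->]]]]] /=.
  exists (size r); split=> //; first by rewrite size_rcons; lia.
  - move=> j; rewrite nth_rcons; case: (ltngtP j (size r)) => // h.
    by rewrite nth_default // ltnW.
  - by move=> j; apply: nth_below.
  - by move=> j; lia.
subst r; exists (size r1); split; rewrite ?size_cat /=; try lia.
- move=> j; rewrite !nth_cat; case: (ltngtP j (size r1)) => [//|h|->]; last by rewrite subnn.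
  by case E: (j - size r1) => [|k] //; move/eqP: E; rewrite subn_eq0 leqNgt h.
- by move=> j jr; rewrite nth_cat jr; apply: nth_below.
- move=> j rj js; rewrite nth_cat ltnNge rj /=.
  case E: (j - size r1) => [|k] //=; apply: (lt_trans xy).
  move: pr; rewrite pairwise_cat /= => /and4P[_ _ /allP h _]; apply: h; apply: mem_nth.
  by rewrite -ltnS -E ltn_subLR.
Qed.

Definition first_row (s : seq int) : seq int := head [::] (RSK_P s).

Lemma first_row_rcons s x : first_row (rcons s x) = (bump_row (first_row s) x).1.
Proof. by rewrite /first_row RSK_P_rcons head_row_insert. Qed.

Lemma first_row_incr s : uniq s -> pairwise lti (first_row s).
Proof. by move=> us; have [] := RSK_P_spec us; rewrite /first_row; case: (RSK_P s) => //= r t []. Qed.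

Lemma mem_first_row s x : uniq s -> x \in first_row s -> x \in s.
Proof. by move=> us h; have [_ /perm_mem <- _] := RSK_P_spec us; apply: mem_head_flatten. Qed.

Lemma pairwise_incr_rcons f l p : pairwise (incr f) (rcons l p) ->
  pairwise (incr f) l /\ all (incr f ^~ p) l.
Proof. by rewrite pairwise_rcons => /andP[]. Qed.

Lemma incr_eq (f g : nat -> int) l N : all (fun p => p < N) l -> (forall p, p < N -> f p = g p) ->
  pairwise (incr f) l = pairwise (incr g) l.
Proof.
move=> hl e; apply: (eq_in_pairwise (P := fun p => p < N)) hl => p q hp hq.
by rewrite /incr !e.
Qed.

(** Together with [schensted_ge]: column [j] of the first row holds the least last value of an
    increasing subsequence with [j + 1] entries. An insertion never increases an entry of the row,
    so the new case is a subsequence ending in the new letter. *)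
Lemma schensted_le s l p : uniq s -> pairwise (incr (nth 0%R s)) (rcons l p) -> p < size s ->
  size l < size (first_row s) /\ (nth 0%R (first_row s) (size l) <= nth 0%R s p)%R.
Proof.
elim/last_ind: s l p => [|s x IH] l p //; rewrite rcons_uniq => /andP[xs us] hl.
rewrite size_rcons ltnS first_row_rcons => hp.
have xf : x \notin first_row s by apply/negP => /(mem_first_row us) h; rewrite h in xs.
have [i [isz sz' ni lti' gei]] := bump_row_at (first_row_incr us) xf.
have [pl /allP lp] := pairwise_incr_rcons hl.
have lps : all (fun q => q < size s) l by apply/allP => q /lp /andP[h _]; lia.
have ers q : q < size s -> nth 0%R (rcons s x) q = nth 0%R s q by move=> h; rewrite nth_rcons h.
rewrite sz' ni; move: hp; rewrite leq_eqVlt => /orP[/eqP ep|hp]; last first.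
  have [|h1 h2] := IH l p us _ hp.
    by rewrite -(incr_eq _ ers) // all_rcons hp.
  rewrite ers //; split; first lia.
  case: eqP => // ei; apply: le_trans h2; apply: ltW; rewrite ei; apply: gei => //.
  by rewrite -ei.
rewrite ep nth_rcons ltnn eqxx.
(* The predecessor of [p] shows that the row entry in column [size l - 1] is below [x]. *)
have li : size l <= i.
  case/lastP: l pl lp lps {hl} => [|l q] // pl lp lps; rewrite size_rcons.
  have qs : q < size s by move: lps; rewrite all_rcons => /andP[].
  have [|h1 h2] := IH l q us _ qs; first by rewrite -(incr_eq lps ers).
  have := lp q; rewrite mem_rcons mem_head => /(_ isT) /andP[_].
  rewrite ep [X in (_ < X)%R]nth_rcons ltnn eqxx ers // => h3.
  rewrite ltnNge; apply/negP => /gei /(_ h1) h4.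
  by have := lt_trans h4 (le_lt_trans h2 h3); rewrite ltxx.
split; first lia.
by case: eqP => // /eqP ne; apply: ltW; apply: lti'; rewrite ltn_neqAle ne.
Qed.

Lemma schensted_ge s j : uniq s -> j < size (first_row s) -> exists l p,
  [/\ pairwise (incr (nth 0%R s)) (rcons l p), p < size s, size l = j &
      nth 0%R s p = nth 0%R (first_row s) j].
Proof.
elim/last_ind: s j => [|s x IH] j //; rewrite rcons_uniq => /andP[xs us].
rewrite first_row_rcons size_rcons.
have xf : x \notin first_row s by apply/negP => /(mem_first_row us) h; rewrite h in xs.
have [i [isz sz' ni lti' gei]] := bump_row_at (first_row_incr us) xf.
have ers q : q < size s -> nth 0%R (rcons s x) q = nth 0%R s q by move=> h; rewrite nth_rcons h.
have lall l p : pairwise (incr (nth 0%R s)) (rcons l p) -> p < size s -> all (fun q => q < size s) (rcons l p).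
  move=> /pairwise_incr_rcons [_ /allP h] hp; rewrite all_rcons hp; apply/allP => q /h /andP[]; lia.
rewrite sz' ni => hj; have [ei|nei] := eqVneq j i; last first.
  have [|l [p [h1 h2 h3 h4]]] := IH j us; first lia.
  exists l, p; split=> //; [|lia|by rewrite ers].
  by rewrite (incr_eq (lall _ _ h1 h2) ers).
subst j; case: (posnP i) => [i0|i0].
  by exists [::], (size s); rewrite nth_rcons ltnn eqxx i0.
have [|l [p [h1 h2 h3 h4]]] := IH i.-1 us; first lia.
exists (rcons l p), (size s); split=> //; last by rewrite nth_rcons ltnn eqxx.
  rewrite pairwise_rcons (incr_eq (lall _ _ h1 h2) ers) h1 andbT.
  have px : (nth 0%R s p < x)%R by rewrite h4; apply: lti'; lia.
  have [_ /allP lp] := pairwise_incr_rcons h1.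
  apply/allP => q; rewrite mem_rcons inE /incr [X in (_ < X)%R]nth_rcons ltnn eqxx => hq.
  have [-> |/lp /andP[qp fq]] := predU1P hq; first by rewrite h2 ers.
  by rewrite ers; [rewrite (lt_trans fq px) andbT|]; lia.
by rewrite size_rcons h3; lia.
Qed.

(** An opposite pair [p, q] or [q, r] would yield a negative pair, so the outer entries are
    opposite. Positive entries of the left half are the negative entries of [w]; a second one would
    form a free triple with [p] and the middle entry or its opposite. *)
Lemma good_triple n f p q r : odd_fun n f -> inj_fun n f -> ~ bad n f ->
  p < q -> q < r -> r < n.*2 -> (f q < f p)%R -> (f r < f q)%R ->
  [/\ (p + r).+1 = n.*2, (0 < f p)%R & forall p', p' < n -> (0 < f p')%R -> p' = p].
Proof.
move=> od ij g pq qr rn fpq fqr.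
have g1 i j : n <= i -> i < j -> j < n.*2 -> (f i < 0)%R -> (f i < f j)%R.
  move=> h1 h2 h3 h4; rewrite lt_neqAle leNgt; apply/andP; split.
    by apply/eqP => /ij; lia.
  by apply/negP => h5; apply: g; left; exists i, j.
have g2 a b c : a < b -> b < c -> c < n.*2 -> (f b < f a)%R -> (f c < f b)%R ->
    [\/ (a + b).+1 = n.*2, (a + c).+1 = n.*2 | (b + c).+1 = n.*2].
  move=> h1 h2 h3 h4 h5.
  have [|n1] := eqVneq (a + b).+1 n.*2; first by constructor 1.
  have [|n2] := eqVneq (a + c).+1 n.*2; first by constructor 2.
  have [|n3] := eqVneq (b + c).+1 n.*2; first by constructor 3.
  by case: g; right; exists a, b, c; split=> //; split; apply/eqP.
have mir a : a < n.*2 -> f (n.*2 - a.+1) = (- f a)%R by move=> h; apply: od; lia.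
have epr : (p + r).+1 = n.*2.
  case: (g2 p q r) => // e.
    have := od _ _ e => e'; have := g1 q r; lia.
  have := od _ _ e => e'; have := g1 r (n.*2 - p.+1); rewrite mir; last lia; lia.
have er := od _ _ epr; have fp : (0 < f p)%R by lia.
split=> // p' hp' fp'; apply/eqP/negPn/negP => ne.
(* The middle entry, reflected into the left half if necessary; its absolute value is below
   [f p]. *)
have [q' [q1 q2 q3 q4]] : exists q', [/\ p < q', q' < n, (f q' < f p)%R & (- f p < f q')%R].
  case: (ltnP q n) => h; first by exists q; split=> //; lia.
  by exists (n.*2 - q.+1); rewrite mir; last lia; split; lia.
have mq' := mir q' ltac:(lia); have mp' := mir p' ltac:(lia); have mp := mir p ltac:(lia).
case: (ltngtP p' p) => [h|h|h]; last by rewrite h eqxx in ne.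
- have lt1 : (f p' < f p)%R by have := g1 (n.*2 - p.+1) (n.*2 - p'.+1); lia.
  have [fq|fq] := ltP 0%R (f q').
    by case: (g2 p q' (n.*2 - p'.+1)); lia.
  by case: (g2 p (n.*2 - q'.+1) (n.*2 - p'.+1)); lia.
- have lt1 : (f p < f p')%R by have := g1 (n.*2 - p'.+1) (n.*2 - p.+1); lia.
  have neq : q' <> p' by move=> e; rewrite e in q3; lia.
  by case: (g2 p q' (n.*2 - p'.+1)); lia.
Qed.

Definition decr (f : nat -> int) : rel nat := fun p q => (p < q) && (f q < f p)%R.

Lemma filter_mem_iota (l : seq nat) N : sorted ltn l -> all (fun p => p < N) l ->
  [seq i <- iota 0 N | i \in l] = l.
Proof.
move=> sl al; apply: (@irr_sorted_eq _ ltn) => //; [exact: ltn_trans|exact: ltnn| |].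
  by apply: sorted_filter; [exact: ltn_trans|exact: iota_ltn_sorted].
move=> x; rewrite mem_filter mem_iota /=; case xl: (x \in l) => //=.
by move/allP: al => /(_ x xl).
Qed.

Lemma pairwise_decr f l : pairwise (decr f) l = pairwise ltn l && pairwise (relpre f gti) l.
Proof. by rewrite -pairwise_relI; apply: eq_pairwise. Qed.

Lemma pairwise_ltn_iota (P : pred nat) m n : pairwise ltn [seq i <- iota m n | P i].
Proof. by apply: pairwise_filter; rewrite -(sorted_pairwise ltn_trans) iota_ltn_sorted. Qed.

Lemma k_decreasingP k m s : k_decreasing k m s <-> exists col : nat -> nat,
  (forall c, c < k -> pairwise (decr (nth 0%R s)) [seq i <- iota 0 (size s) | col i == c]) /\
  m <= count (fun i => col i < k) (iota 0 (size s)).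
Proof.
split=> [[cs [e hd hm]]|[col [hd hm]]].
  have sz : size cs = size s by rewrite -e size_map.
  have ecs : cs = [seq nth (0%R, k) cs i | i <- iota 0 (size s)].
    by rewrite -sz; apply: esym; apply: mkseq_nth.
  have fstE i : (nth (0%R, k) cs i).1 = nth 0%R s i.
    by rewrite -e; case: (ltnP i (size cs)) => h; [rewrite (nth_map (0%R, k))|rewrite !nth_default ?size_map].
  exists (fun i => (nth (0%R, k) cs i).2); split.
    move=> c ck; rewrite pairwise_decr pairwise_ltn_iota /=.
    have := hd c ck; rewrite /proj {1}ecs filter_map -map_comp pairwise_map.
    by apply: sub_pairwise => i j; rewrite /= !fstE.
  by move: hm; rewrite /coloured {1}ecs count_map.
exists [seq (nth 0%R s i, col i) | i <- iota 0 (size s)]; split.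
- by rewrite -map_comp; apply: mkseq_nth.
- move=> c ck; rewrite /proj filter_map -map_comp pairwise_map.
  by have := hd c ck; rewrite pairwise_decr => /andP[].
- by rewrite /coloured count_map.
Qed.

Lemma k_decreasing_one l s : pairwise (decr (nth 0%R s)) l -> all (fun p => p < size s) l ->
  k_decreasing 1 (size l) s.
Proof.
move=> hd hl; have sl : sorted ltn l.
  by move: hd; rewrite pairwise_decr (sorted_pairwise ltn_trans) => /andP[].
apply/k_decreasingP; exists (fun i => (i \notin l) : nat); split.
  case=> // _; rewrite (eq_filter (a2 := mem l)) ?filter_mem_iota // => i /=; by case: (i \in l).
rewrite -[X in X <= _](congr1 size (filter_mem_iota sl hl)) size_filter.
by apply: sub_count => i /= ->.
Qed.

Lemma k_decreasing_two l1 l2 s : pairwise (decr (nth 0%R s)) l1 -> pairwise (decr (nth 0%R s)) l2 ->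
  all (fun p => p < size s) l1 -> all (fun p => p < size s) l2 -> ~~ has (mem l1) l2 ->
  k_decreasing 2 (size l1 + size l2) s.
Proof.
move=> hd1 hd2 hl1 hl2 /hasPn dis.
have sl1 : sorted ltn l1 by move: hd1; rewrite pairwise_decr (sorted_pairwise ltn_trans) => /andP[].
have sl2 : sorted ltn l2 by move: hd2; rewrite pairwise_decr (sorted_pairwise ltn_trans) => /andP[].
have dis' i : i \in l2 -> (i \in l1) = false by move=> /dis /negbTE.
apply/k_decreasingP; exists (fun i => if i \in l1 then 0 else if i \in l2 then 1 else 2); split.
  case=> [|[|//]] _.
    rewrite (eq_filter (a2 := mem l1)) ?filter_mem_iota // => i /=.
    by case: (i \in l1) => //; case: (i \in l2).
  rewrite (eq_filter (a2 := mem l2)) ?filter_mem_iota // => i /=.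
  by case h: (i \in l2); [rewrite dis'|case: (i \in l1)].
rewrite -{1}(filter_mem_iota sl1 hl1) -{1}(filter_mem_iota sl2 hl2) !size_filter.
rewrite -count_predUI [X in _ + X](eq_count (a2 := pred0)) ?count_pred0 ?addn0.
  by apply: sub_count => i /= /orP[->|->] //; case: ifP.
by move=> i /=; case h: (i \in l2); [rewrite dis'|rewrite andbF].
Qed.

Lemma decr_size3 f (P : pred nat) N : pairwise (decr f) [seq i <- iota 0 N | P i] ->
  3 <= size [seq i <- iota 0 N | P i] ->
  exists p q r, [/\ p < q, q < r, r < N & (f q < f p)%R] /\ [/\ (f r < f q)%R & P p].
Proof.
case e: (filter P _) => [|p [|q [|r l]]] //= /andP[/andP[/andP[pq fpq] _] /andP[/andP[/andP[qr fqr] _] _]] _.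
have hp : p \in [seq i <- iota 0 N | P i] by rewrite e inE eqxx.
have hr : r \in [seq i <- iota 0 N | P i] by rewrite e !inE eqxx !orbT.
move: hp hr; rewrite !mem_filter !mem_iota => /andP[Pp _] /andP[_ rN].
by exists p, q, r.
Qed.

Lemma decr_size4 f (P : pred nat) N : pairwise (decr f) [seq i <- iota 0 N | P i] ->
  4 <= size [seq i <- iota 0 N | P i] ->
  exists p q r t, [/\ p < q, q < r, r < t, t < N & (f q < f p)%R] /\ [/\ (f r < f q)%R & (f t < f r)%R].
Proof.
case e: (filter P _) => [|p [|q [|r [|t l]]]] //=.
move=> /and4P[/andP[/andP[pq fpq] _] /andP[/andP[qr fqr] _] /andP[/andP[rt frt] _] _] _.
have : t \in [seq i <- iota 0 N | P i] by rewrite e !inE eqxx !orbT.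
by rewrite !mem_filter !mem_iota => /andP[_ tN]; exists p, q, r, t.
Qed.

Lemma good_no_decr4 n f (P : pred nat) : odd_fun n f -> inj_fun n f -> ~ bad n f ->
  pairwise (decr f) [seq i <- iota 0 n.*2 | P i] -> size [seq i <- iota 0 n.*2 | P i] <= 3.
Proof.
move=> od ij g hd; rewrite leqNgt; apply/negP => /(decr_size4 hd).
move=> [p [q [r [t [[pq qr rt tn fpq] [fqr frt]]]]]].
have [e1 _ _] := good_triple od ij g pq qr (ltn_trans rt tn) fpq fqr.
have [e2 _ _] := good_triple od ij g pq (ltn_trans qr rt) tn fpq (lt_trans frt fqr).
by move: e1 e2; lia.
Qed.

Lemma count_lt_succ k (col : nat -> nat) (l : seq nat) :
  count (fun i => col i < k.+1) l = count (fun i => col i < k) l + count (fun i => col i == k) l.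
Proof. by elim: l => //= i l ->; rewrite ltnS leq_eqVlt; case: (ltngtP (col i) k) => /=; lia. Qed.

Lemma count_lt0 (col : nat -> nat) (l : seq nat) : count (fun i => col i < 0) l = 0.
Proof. by rewrite (eq_count (a2 := pred0)) ?count_pred0. Qed.

(** In a decreasing quadruple two different entries would be opposite to the first. Six letters in
    two colours would be two disjoint triples, both starting at the unique positive entry of the
    left half. *)
Lemma good_k_decreasing n w : signed_perm n w -> ~ bad n (sym_fun w) ->
  ~ k_decreasing 1 4 (w0 w) /\ ~ k_decreasing 2 6 (w0 w).
Proof.
move=> sp g; have [sz _] := sp; have od := @sym_fun_odd w; rewrite sz in od.
have ij := sym_fun_inj sp; have sz0 : size (w0 w) = n.*2 by rewrite size_w0 sz.
split=> /k_decreasingP [col []]; rewrite sz0 !count_lt_succ count_lt0 -!size_filter => hd.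
  by have := good_no_decr4 od ij g (hd 0 isT); lia.
have l0 := good_no_decr4 od ij g (hd 0 isT); have l1 := good_no_decr4 od ij g (hd 1 isT) => hm.
have [|p [q [r [[pq qr rn fpq] [fqr /eqP cp]]]]] := decr_size3 (hd 0 isT); first lia.
have [|p' [q' [r' [[pq' qr' rn' fpq'] [fqr' /eqP cp']]]]] := decr_size3 (hd 1 isT); first lia.
have [_ _ u] := good_triple od ij g pq qr rn fpq fqr.
have [e' pos' _] := good_triple od ij g pq' qr' rn' fpq' fqr'.
have epp : p' = p by apply: u => //; lia.
by rewrite epp cp in cp'.
Qed.

Lemma bad_k_decreasing n w : signed_perm n w -> bad n (sym_fun w) ->
  k_decreasing 1 4 (w0 w) \/ k_decreasing 2 6 (w0 w).
Proof.
move=> sp; have [sz _] := sp; have od := @sym_fun_odd w; rewrite sz in od.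
have sz0 : size (w0 w) = n.*2 by rewrite size_w0 sz.
have mir a : a < n.*2 -> sym_fun w (n.*2 - a.+1) = (- sym_fun w a)%R by move=> h; apply: od; lia.
case=> [[i [j [ni ij jn fi fj]]]|[p [q [r [[pq qr rn] [fpq fqr] [n1 n2 n3]]]]]].
  left; apply: (@k_decreasing_one [:: n.*2 - j.+1; n.*2 - i.+1; i; j]).
    rewrite /= /decr -!/(sym_fun w _) !mir; lia.
  by rewrite /= sz0; lia.
right; have hp := mir p ltac:(lia); have hq := mir q ltac:(lia); have hr := mir r ltac:(lia).
apply: (@k_decreasing_two [:: p; q; r] [:: n.*2 - r.+1; n.*2 - q.+1; n.*2 - p.+1]).
- by rewrite /= /decr -!/(sym_fun w _); lia.
- by rewrite /= /decr -!/(sym_fun w _) hp hq hr; lia.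
- by rewrite /= sz0; lia.
- by rewrite /= sz0; lia.
- by rewrite /= !inE; lia.
Qed.

Lemma goodP n w : signed_perm n w ->
  (greene 1 (lambda w) <= 3 /\ greene 2 (lambda w) <= 5) <-> ~ bad n (sym_fun w).
Proof.
move=> sp; have us := uniq_w0 sp; have g k m := greene_columns k m us.
split=> [[h1 h2] /(bad_k_decreasing sp) [/g|/g]|/(good_k_decreasing sp) [h1 h2]].
- by rewrite leqNgt ltnS h1.
- by rewrite leqNgt ltnS h2.
- by split; rewrite leqNgt; apply/negP => /g.
Qed.

(** * Parity of the first row *)

Definition mirror (n : nat) (l : seq nat) : seq nat := [seq n.*2 - p.+1 | p <- rev l].

Lemma size_mirror n l : size (mirror n l) = size l.
Proof. by rewrite size_map size_rev. Qed.

Lemma mirror_cat n a b : mirror n (a ++ b) = mirror n b ++ mirror n a.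
Proof. by rewrite /mirror rev_cat map_cat. Qed.

Lemma all_mirror n (P : pred nat) l : all P (mirror n l) = all (fun p => P (n.*2 - p.+1)) l.
Proof. by rewrite /mirror all_map all_rev. Qed.

Lemma pairwise_mirror n f l : odd_fun n f -> all (fun p => p < n.*2) l ->
  pairwise (incr f) l -> pairwise (incr f) (mirror n l).
Proof.
move=> od hl; rewrite /mirror pairwise_map.
elim: l hl => [|p l IH] //= /andP[pn hl] /andP[/allP hp hd].
rewrite rev_cons pairwise_rcons (IH hl hd) andbT; apply/allP => q; rewrite mem_rev => ql.
move/allP: hl => /(_ q ql) qn; have /andP[pq fpq] := hp q ql.
rewrite /= /incr (od p (n.*2 - p.+1)); last lia.
by rewrite (od q (n.*2 - q.+1)); lia.
Qed.

(** The reflected part has positive values in the right half, so it continues the negative values of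
    [l]. Maximality of a subsequence is always tested against such doublings. *)
Lemma symmetric_incr n f l : odd_fun n f -> all (fun p => (p < n) && (f p < 0)%R) l ->
  pairwise (incr f) l -> pairwise (incr f) (l ++ mirror n l) /\ all (fun p => p < n.*2) (l ++ mirror n l).
Proof.
move=> od /allP hl hd.
have hl2 : all (fun p => p < n.*2) l by apply/allP => p /hl /andP[h _]; lia.
split; last by rewrite all_cat hl2 all_mirror; apply/allP => p /hl /andP[h _] /=; lia.
rewrite pairwise_cat hd pairwise_mirror // !andbT; apply/allrelP => p q /hl /andP[pn fp].
move=> /mapP[q']; rewrite mem_rev => /hl /andP[qn fq] ->.
rewrite /incr (od q' (n.*2 - q'.+1)); lia.
Qed.

(* By uniqueness [p] is the last entry of [l1]. Either half of [l1 ++ l2] can be completed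
   symmetrically, and [p] can be traded for an entry between [p] and [r] and its mirror. *)
Lemma odd_incr_extend n f p q r l1 l2 : odd_fun n f -> inj_fun n f -> ~ bad n f ->
  p < q -> q < r -> r < n.*2 -> (f q < f p)%R -> (f r < f q)%R ->
  pairwise (incr f) (l1 ++ l2) -> all (fun p => p < n) l1 ->
  all (fun p => n <= p < n.*2) l2 -> has (fun p => 0 < f p)%R l1 ->
  odd (size l1 + size l2) ->
  (forall l, pairwise (incr f) l -> all (fun p => p < n.*2) l -> size l <= size l1 + size l2) -> False.
Proof.
move=> od ij g pq qr rn fpq fqr; have [epr fp uniqp] := good_triple od ij g pq qr rn fpq fqr.
have mir a : a < n.*2 -> f (n.*2 - a.+1) = (- f a)%R by move=> h; apply: od; lia.
rewrite pairwise_cat => /and3P[/allrelP rel hd1 hd2] hl1 /allP hl2 /hasP[x xl1 fx] odd_sz bound.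
have {fx} ? : x = p by apply: uniqp => //; move/allP: hl1; apply.
subst x; case/splitPr: xl1 hd1 hl1 rel bound odd_sz => [N N'].
rewrite pairwise_cat all_cat /= => /and4P[relN hdN /allP hpN' _] /and3P[/allP hN pn /allP hN'] rel.
have -> : N' = [::].
  case: N' hpN' hN' {relN rel} => // u N' h1 h2.
  have /andP[pu fpu] := h1 u (mem_head _ _); have un := h2 u (mem_head _ _).
  have := uniqp u un (lt_trans fp fpu); lia.
rewrite size_cat /= addn1 => bound odd_sz.
have Np u : u \in N -> u < p by move=> uN; have /allrelP/(_ u p uN (mem_head _ _))/andP[] := relN.
have fN u : u \in N -> (f u < 0)%R.
  move=> uN; have un := hN u uN; have up := Np u uN.
  case: (ltgtP (f u) 0%R) => // h; first by have := uniqp u un h; lia.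
  have := ij u (n.*2 - u.+1); rewrite mir; lia.
have fl2 u : u \in l2 -> (0 < f u)%R.
  move=> ul2; have /andP[_] : incr f p u by apply: rel => //; rewrite mem_cat mem_head orbT.
  exact: lt_trans.
have symN : size N + size N <= (size N).+1 + size l2.
  have [|h1 h2] := @symmetric_incr n f N od _ hdN; first by apply/allP => u uN; rewrite hN ?fN.
  by have := bound _ h1 h2; rewrite size_cat size_mirror.
have l2n : all (fun p => p < n.*2) l2 by apply/allP => u /hl2 /andP[].
have syml2 : size l2 + size l2 <= (size N).+1 + size l2.
  have [|h1 h2] := @symmetric_incr n f (mirror n l2) od _ (pairwise_mirror od l2n hd2).
    rewrite all_mirror; apply/allP => u ul2; rewrite mir; last by have := hl2 u ul2; lia.
    by have := fl2 u ul2; have := hl2 u ul2; lia.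
  by have := bound _ h1 h2; rewrite size_cat !size_mirror.
(* [q] or its opposite, whichever is in the left half; it is negative because [p] is the only
   positive entry there. *)
have [q' [q1 q2 q3 q4]] : exists q', [/\ p < q', q' < n, (f q' < 0)%R & (- f q' < f p)%R].
  have fr := od _ _ epr.
  have [a [a1 a2 a3 a4]] : exists a, [/\ p < a, a < n, (f a < f p)%R & (- f p < f a)%R].
    case: (ltnP q n) => h; first by exists q; split=> //; lia.
    by exists (n.*2 - q.+1); rewrite mir; last lia; split; lia.
  exists a; split=> //; last lia.
  case: (ltgtP (f a) 0%R) => // h; first by have := uniqp a a2 h; lia.
  have := ij a (n.*2 - a.+1); rewrite mir; lia.
(* Here [q'] replaces [p]. An entry [u] of [N] with a value above that of [q'] would give the
   decreasing triple of [p], the opposite of [q'] and the opposite of [u], whose ends are not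
   opposite. *)
have symNq : (size N).+1 + (size N).+1 <= (size N).+1 + size l2.
  have [||h1 h2] := @symmetric_incr n f (rcons N q') od.
  - rewrite all_rcons q2 q3; apply/allP => u uN; by rewrite hN ?fN.
  - rewrite pairwise_rcons hdN andbT; apply/allP => u uN; have up := Np u uN.
    have un := hN u uN; rewrite /incr; apply/andP; split; first lia.
    case: (ltgtP (f u) (f q')) => // h; last by have := ij u q'; lia.
    have mu := mir u ltac:(lia); have mq := mir q' ltac:(lia).
    have [] := @good_triple n f p (n.*2 - q'.+1) (n.*2 - u.+1) od ij g; lia.
  - by have := bound _ h1 h2; rewrite size_cat size_mirror size_rcons.
have e : size l2 = (size N).+1 by clear - symNq syml2; lia.
by rewrite e addnn odd_double in odd_sz.
Qed.

Lemma split_incr_at n (l : seq nat) (f : nat -> int) N : pairwise (incr f) l -> all (fun p => p < N) l ->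
  exists l1 l2, [/\ l = l1 ++ l2, all (fun p => p < n) l1 & all (fun p => n <= p < N) l2].
Proof.
elim: l => [|p l IH] /=; first by exists [::], [::].
move=> /andP[/allP hp hd] /andP[pN hN]; case: (ltnP p n) => pn.
  by have [l1 [l2 [-> h1 h2]]] := IH hd hN; exists (p :: l1), l2; rewrite /= pn.
exists [::], (p :: l); split=> //=; rewrite pn pN; apply/allP => q ql.
by have /andP[h _] := hp q ql; move/allP: hN => /(_ q ql); lia.
Qed.

(** A positive entry in the left half is the case of [odd_incr_extend], and a negative one in the
    right half reduces to it by mirroring. Otherwise each half can be doubled, so maximality makes
    the halves equally long. *)
Lemma even_longest n f p q r l : odd_fun n f -> inj_fun n f -> ~ bad n f ->
  p < q -> q < r -> r < n.*2 -> (f q < f p)%R -> (f r < f q)%R ->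
  pairwise (incr f) l -> all (fun p => p < n.*2) l ->
  (forall l', pairwise (incr f) l' -> all (fun p => p < n.*2) l' -> size l' <= size l) ->
  ~~ odd (size l).
Proof.
move=> od ij g pq qr rn fpq fqr hd hl bound; apply/negP => odd_l.
have mir a : a < n.*2 -> f (n.*2 - a.+1) = (- f a)%R by move=> h; apply: od; lia.
have ext := odd_incr_extend od ij g pq qr rn fpq fqr.
have [l1 [l2 [el h1 h2]]] := split_incr_at n hd hl; subst l.
rewrite size_cat in odd_l bound.
have [pos|/hasPn npos] := boolP (has (fun p => 0 < f p)%R l1); first exact: (ext l1 l2).
have [neg|/hasPn nneg] := boolP (has (fun p => f p < 0)%R l2).
  apply: (ext (mirror n l2) (mirror n l1)).
  - by rewrite -mirror_cat; apply: pairwise_mirror.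
  - by rewrite all_mirror; apply: sub_all h2 => u; lia.
  - by rewrite all_mirror; apply: sub_all h1 => u; lia.
  - case/hasP: neg => u ul2 fu; apply/hasP; exists (n.*2 - u.+1).
      by apply/mapP; exists u; rewrite ?mem_rev.
    by rewrite mir; [lia|move/allP: h2 => /(_ u ul2); lia].
  - by rewrite !size_mirror addnC.
  - by move=> l' a b; rewrite !size_mirror addnC; apply: bound.
have f0 u : u < n.*2 -> f u <> 0%R.
  by move=> un e; have := ij u (n.*2 - u.+1); rewrite mir //; lia.
move: hd; rewrite pairwise_cat => /and3P[_ hd1 hd2].
have hl2 : all (fun p => p < n.*2) l2 by apply: sub_all h2 => u /andP[].
have s1 : size l1 + size l1 <= size l1 + size l2.
  have [|a b] := @symmetric_incr n f l1 od _ hd1.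
    apply/allP => u ul; move/allP: h1 => /(_ u ul) un; have := npos u ul; have := f0 u; lia.
  by have := bound _ a b; rewrite size_cat size_mirror.
have s2 : size l2 + size l2 <= size l1 + size l2.
  have [|a b] := @symmetric_incr n f (mirror n l2) od _ (pairwise_mirror od hl2 hd2).
    rewrite all_mirror; apply/allP => u ul; move/allP: h2 => /(_ u ul) un.
    by rewrite mir; [have := nneg u ul; have := f0 u; lia|lia].
  by have := bound _ a b; rewrite size_cat !size_mirror.
have e : size l2 = size l1 by clear - s1 s2; lia.
by rewrite e addnn odd_double in odd_l.
Qed.

Lemma even_first_row n w : signed_perm n w -> ~ bad n (sym_fun w) -> k_decreasing 1 3 (w0 w) ->
  ~~ odd (size (first_row (w0 w))).
Proof.
move=> sp g; have [sz _] := sp; have od := @sym_fun_odd w; rewrite sz in od.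
have ij := sym_fun_inj sp; have sz0 : size (w0 w) = n.*2 by rewrite size_w0 sz.
have us := uniq_w0 sp.
move/k_decreasingP => [col []]; rewrite sz0 !count_lt_succ count_lt0 -!size_filter => hd hm.
have [|p [q [r [[pq qr rn fpq] [fqr _]]]]] := decr_size3 (hd 0 isT); first lia.
case e: (size (first_row (w0 w))) => [//|m].
have [|l [u [h1 h2 h3 h4]]] := @schensted_ge (w0 w) m us; first by rewrite e.
have <- : size (rcons l u) = m.+1 by rewrite size_rcons h3.
apply: (@even_longest n (sym_fun w) p q r) => //.
- rewrite all_rcons -sz0 h2; apply/allP => a; have [_ /allP h /h /andP[au _]] := pairwise_incr_rcons h1; exact: ltn_trans h2.
- move=> l'; case/lastP: l' => [//|l' a] ha; rewrite all_rcons -sz0 => /andP[an _].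
  by have [h _] := schensted_le us ha an; rewrite !size_rcons h3 -e.
Qed.

(** * Admissible shapes *)

Lemma greene1 lam : all (fun a => 0 < a) lam -> greene 1 lam = size lam.
Proof.
rewrite /greene; elim: lam => [|a lam IH] /=; first by rewrite big_nil.
by move=> /andP[a0 /IH]; rewrite big_cons => ->; lia.
Qed.

Lemma tableau_shape t : tableau t -> all (fun a => 0 < a) (map size t) /\ sorted geq (map size t).
Proof.
elim: t => //= r t IH [r0 _ [hs _] /IH [h1 h2]]; rewrite r0; split=> //.
by case: t hs h2 {IH h1} => //= s t -> ->.
Qed.

Lemma sum_shape n w : signed_perm n w -> sumn (lambda w) = n.*2.
Proof.
move=> sp; have [_ /perm_size h _] := RSK_P_spec (uniq_w0 sp).
by move: h; rewrite size_flatten size_w0; case: sp => -> _.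
Qed.

Lemma admissibleP n w : 1 <= n -> signed_perm n w ->
  admissible n (lambda w) <-> ~ bad n (sym_fun w).
Proof.
move=> n1 sp; rewrite -(goodP sp); split.
  case=> [[k [kn ->]]|[k [kn ->]]]; last by rewrite /greene !big_cons !big_nil; lia.
  by rewrite /= /greene; case: ifP; case: ifP; rewrite ?big_cons !big_nil; lia.
move=> [g1 g2]; have g : ~ bad n (sym_fun w) by apply/(goodP sp).
have us := uniq_w0 sp; have [tt _ _] := RSK_P_spec us.
have [pos srt] := tableau_shape tt; have sm := sum_shape sp.
have ev := even_first_row sp g; rewrite greene_columns // in ev.
have fr : head 0 (lambda w) = size (first_row (w0 w)).
  by rewrite /lambda /first_row; case: (RSK_P _).
rewrite -fr -/(lambda w) in ev; rewrite -/(lambda w) in pos srt.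
rewrite greene1 // in g1 ev.
case: (lambda w) pos srt g1 g2 sm ev => [|a [|b [|c [|//]]]] /=.
- by lia.
- move=> a0 _ _ _ sm _; left; exists 0; split=> //=; rewrite ifT; last by lia.
  by congr [:: _]; lia.
- move=> ab0 srt _ _ sm _; left; exists b; split; first by lia.
  by rewrite /= ifT; [rewrite ifT; [congr [:: _; _]; lia|lia]|lia].
- move=> abc srt _ + sm /(_ isT) ev; rewrite /greene !big_cons big_nil => g2.
  (* As [a] is even and [a + b + c = 2n] with [c = 1], [b] is odd and [b = 2k - 1] for this [k];
     [b <= a] gives [k <= n/2]. *)
  right; exists b.+1./2; split; first by lia.
  (* With [c >= 2] the first two columns would have 6 cells. *)
  have -> : c = 1 by lia.
  by congr [:: _; _; _]; lia.
Qed.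

Unset Implicit Arguments.

Theorem mainTheorem6 (n : nat) (w : seq int) :
  1 <= n -> signed_perm n w ->
  (fully_commutative n w <-> admissible n (lambda w)).
Proof. by move=> n1 sp; rewrite fully_commutativeE // admissibleP. Qed.
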